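(* If $H$ is a $wq$-normal subgroup of a countable group $\Gamma$ and $H$ is an obstacle to uniqueness, then $\Gamma$ is an obstacle to uniqueness.
   Context: An infinite subgroup $H$ of a group $\Gamma$ is $wq$-normal in $\Gamma$ if for every intermediate subgroup $H\subseteq I\subsetneq\Gamma$ there exists $g\in\Gamma\setminus I$ such that $gIg^{-1}\cap I$ is infinite. Cayley graphs are taken with respect to finite generating sets. $G_p$ denotes Bernoulli bond percolation on a graph $G$: each edge is independently retained with probability $p$ and deleted otherwise; connected components of $G_p$ are called clusters. For a set $A$ of vertices, a cluster $K$ is $A$-infinite if $|K\cap A|=\infty$, and $p_u(A;G)=\inf\{p\in[0,1]:\text{there exists a unique }A\text{-infinite cluster in }G_p\text{ a.s.}\}$. A countable group $\Gamma$ is an obstacle to uniqueness if, whenever $G$ is a Cayley graph of a finitely generated group $\tilde\Gamma$ containing $\Gamma$ as a subgroup, it is not the case that $G_p$ with $p=p_u(\Gamma;G)$ has a unique $\Gamma$-infinite cluster almost surely. *)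

(* Defs.v *)
From HB Require Import structures.
From Stdlib Require Import Relations.
From mathcomp Require Import all_boot all_order all_algebra.
From mathcomp Require Import all_classical all_reals all_analysis.
From mathcomp Require Import lra.

Set Implicit Arguments.
Unset Strict Implicit.
Unset Printing Implicit Defensive.

Import Order.TTheory GRing.Theory Num.Theory.

Local Open Scope classical_set_scope.
Local Open Scope ring_scope.

Section Subgroups.
Variable G : groupType.
Implicit Types H I S : set G.

Definition is_subgroup H : Prop := group_closed [in H].

Definition generates S : Prop :=
  forall I, is_subgroup I -> S `<=` I -> I = setT.

Definition conjugate (g : G) I : set G := [set (g * x * g^-1)%g | x in I].

Definition wq_normal H : Prop :=
  infinite_set H /\
  forall I, is_subgroup I -> H `<=` I -> I <> setT ->
    exists2 g : G, ~ I g & infinite_set (conjugate g I `&` I).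

End Subgroups.

(* A subgroup H of G, seen as a group in its own right. *)
Section SubgroupType.
Variables (G : groupType) (H : set G) (sgH : is_subgroup H).

Definition subgroup_type of is_subgroup H : Type := {x : G | x \in H}.

HB.instance Definition _ :=
  [isSub of subgroup_type sgH for @sval G (fun x => x \in H)].
HB.instance Definition _ := [Choice of subgroup_type sgH by <:].
HB.instance Definition _ :=
  SubChoice_isSubGroup.Build G [in H] (subgroup_type sgH) sgH.

End SubgroupType.

Definition independent_events d (T : measurableType d) (R : realType)
    (P : probability T R) (I : choiceType) (A : I -> set T) : Prop :=
  forall s : seq I, uniq s ->
    P (\bigcap_(i in [set` s]) A i) = (\prod_(i <- s) P (A i))%E.

(* Graphs are given by their vertex type V and their set E of edges, an edge
   being a set of two vertices; E -> bool is the set of bond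
   configurations, [true] meaning that the edge is retained. *)
Section Percolation.
Variables (V : choiceType) (E : set (set V)).

Definition edge_open (e : E) : set (E -> bool) := [set w | w e].

(* bond configurations with the product sigma-algebra *)
Definition config : measurableType (range edge_open).-sigma :=
  g_sigma_algebraType (range edge_open).

Definition open_adjacent (w : config) (x y : V) : Prop :=
  exists2 e : E, w e & \val e = [set x; y].

Definition cluster_of (w : config) (x : V) : set V :=
  [set y | clos_refl_trans V (open_adjacent w) x y].

Definition is_cluster (w : config) (K : set V) : Prop :=
  exists x, K = cluster_of w x.

Definition unique_infinite_cluster (A : set V) (w : config) : Prop :=
  exists! K, is_cluster w K /\ infinite_set (K `&` A).

Variable R : realType.

(* mu is the law of Bernoulli-p bond percolation. For countable E such a law
   exists (bernoulli_percolation_exists and countable_cayley_edges below), and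
   it is unique because the finite intersections of the events edge_open e form
   a pi-system generating the product sigma-algebra. *)
Definition bernoulli_percolation (p : R) (mu : probability config R) : Prop :=
  (forall e, mu (edge_open e) = p%:E) /\ independent_events mu edge_open.

Definition as_unique_infinite_cluster (p : R) (A : set V) : Prop :=
  forall mu : probability config R, bernoulli_percolation p mu ->
    {ae mu, forall w, unique_infinite_cluster A w}.

Definition p_u (A : set V) : R :=
  inf [set p : R | 0 <= p <= 1 /\ as_unique_infinite_cluster p A].

End Percolation.

Arguments as_unique_infinite_cluster {V} E {R} p A.
Arguments p_u {V} E {R} A.

(* Edge set of the (simple, undirected) right Cayley graph: {x, x s}, s != 1. *)
Definition cayley_edges (G : groupType) (S : set G) : set (set G) :=
  [set e | exists x s, [/\ S s, s <> 1%g & e = [set x; (x * s)%g]]].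

(* Existence of Bernoulli percolation on countably many edges: a uniform
   u in [0, 1[ yields i.i.d. Bernoulli-p bits by iterating the map below and
   testing at each stage whether the current value is smaller than p. *)
Section BernoulliBits.
Variables (R : realType) (p : R).
Hypothesis p01 : 0 <= p <= 1.

Let shift (u : R) : R := if u < p then u / p else (u - p) / (1 - p).
Let bit (n : nat) (u : R) : bool := iter n shift u < p.

Let weight (o : option bool) : R :=
  if o is Some b then if b then p else 1 - p else 1.

Let pattern n (q : nat -> option bool) : set R :=
  [set u | 0 <= u < 1 /\
     forall i b, (i < n)%N -> q i = Some b -> bit i u = b].

Let weight_ge0 o : 0 <= weight o.
Proof. by move/andP: p01 => [? ?]; rewrite /weight; case: o => [[]|]; lra. Qed.

Let pattern_itv n (b : nat -> bool) :
  let l := \prod_(i < n) weight (Some (b i)) in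
  exists a, forall u,
    (pattern n (Some \o b) u <-> a <= u < a + l) /\
    (a <= u < a + l -> iter n shift u * l = u - a).
Proof.
elim: n => [|n [a IH]] /=.
  exists 0 => u; rewrite big_ord0; split; last by move=> _ /=; lra.
  rewrite add0r; split; first by case.
  by move=> u01; split.
rewrite big_ord_recr /=; set l := \prod_(i < n) _ in IH *.
have l0 : 0 <= l by apply: prodr_ge0.
have patS u : pattern n.+1 (Some \o b) u <->
    a <= u < a + l /\ bit n u = b n.
  rewrite -(IH u).1; split.
    move=> [u01 hu]; split; last by apply: hu.
    by split=> // i c /ltnW lin; apply: hu.
  move=> [[u01 hu] hn]; split=> // i c; rewrite ltnS leq_eqVlt.
  by case/predU1P => [-> [<-]//|lin]; apply: hu.
exists (if b n then a else a + l * p) => u.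
have key : a <= u < a + l -> bit n u = (u < a + l * p).
  move=> hu; have := (IH u).2 hu; rewrite /bit.
  have lp : 0 < l by lra.
  move=> e; rewrite -(ltr_pM2r lp) e mulrC; apply/idP/idP; lra.
have e1 : pattern n.+1 (Some \o b) u <->
    (if b n then a else a + l * p) <= u <
    (if b n then a else a + l * p) + l * (if b n then p else 1 - p).
  rewrite patS; have /andP[p0 p1] := p01.
  have lp : 0 <= l * p by apply: mulr_ge0.
  have lp1 : l * p <= l by apply: ler_piMr.
  have -> : l * (if b n then p else 1 - p) = if b n then l * p else l - l * p.
    by case: (b n); rewrite // mulrBr mulr1.
  case: (b n); split.
  - by move=> [h]; rewrite key// -/(is_true _) => h2; lra.
  - move=> h; have h' : a <= u < a + l by lra.
    by split=> //; rewrite key// -/(is_true _); lra.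
  - by move=> [h]; rewrite key// => /negbT; rewrite -leNgt => h2; lra.
  - move=> h; have h' : a <= u < a + l by lra.
    by split=> //; rewrite key//; apply/negbTE; rewrite -leNgt; lra.
split=> // /e1 /patS [h bn].
have := (IH u).2 h; move: bn; rewrite /bit; set v := iter n _ _.
move=> bn e; have l_gt0 : 0 < l by lra.
have v0 : 0 <= v by rewrite -(pmulr_lge0 _ l_gt0) e; lra.
have v1 : v < 1 by rewrite -(ltr_pM2r l_gt0) e; lra.
rewrite /shift bn /weight; case: (b n) bn => [vp|/negbT].
  have p0 : p != 0 by apply: lt0r_neq0; lra.
  by rewrite mulrCA divfK// mulrC.
rewrite -leNgt => vp; have p1 : 1 - p != 0 by apply: lt0r_neq0; lra.
by rewrite mulrCA divfK// mulrBr (mulrC l v) e; lra.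
Qed.

Let mu_pattern n (q : nat -> option bool) :
  measurable (pattern n q) /\
  lebesgue_measure (pattern n q) = (\prod_(i < n) weight (q i))%:E.
Proof.
have [k] := ubnP (\sum_(i < n) (q i == None)); elim: k q => // k IH q.
rewrite ltnS => hk.
have [[j qj]|nq] := pselect (exists j : 'I_n, q j = None); last first.
  pose b i := odflt true (q i).
  have qb i : (i < n)%N -> q i = Some (b i).
    move=> lin; rewrite /b; case e : (q i) => [//|].
    by exfalso; apply: nq; exists (Ordinal lin).
  have -> : pattern n q = pattern n (Some \o b).
    rewrite /pattern; apply/seteqP; split => u /= [u01 hu]; split=> // i c lin.
      by move=> e; apply: hu => //; rewrite qb.
    by rewrite qb//; apply: hu.
  have [a ha] := pattern_itv n b; set l := \prod_(i < n) _ in ha.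
  have -> : pattern n (Some \o b) = `[a, a + l[%classic.
    apply/seteqP; split => u /=; rewrite in_itv /=.
      by move/(ha u).1.
    by move=> h; apply/(ha u).1.
  split; first exact: measurable_itv.
  rewrite lebesgue_measure_itv /= lte_fin ltrDl -EFinB addrAC subrr add0r.
  have -> : \prod_(i < n) weight (q i) = l.
    by apply: eq_bigr => i _; rewrite qb.
  have : 0 <= l by apply: prodr_ge0.
  by rewrite le_eqVlt => /predU1P[<-|->//]; rewrite ltxx.
pose q' c i := if i == j :> nat then Some c else q i.
have hq c : measurable (pattern n (q' c)) /\
    lebesgue_measure (pattern n (q' c)) = (\prod_(i < n) weight (q' c i))%:E.
  apply: IH; apply: leq_trans hk; rewrite (bigD1 j)//= [ltnRHS](bigD1 j)//=.
  rewrite /q' eqxx qj /= add0n add1n ltnS; apply: leq_sum => i ij.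
  by rewrite val_eqE (negbTE ij).
have -> : pattern n q = pattern n (q' true) `|` pattern n (q' false).
  apply/seteqP; split => [u [u01 hu]|u].
    case e : (bit j u); [left|right]; split=> // i c lin; rewrite /q';
    by case: eqP => [->[<-]|_] //; apply: hu.
  by case=> -[u01 hu]; split=> // i c lin qi; apply: hu => //; rewrite /q';
    case: eqP => // ij; move: qi; rewrite ij qj.
split; first by apply: measurableU; [apply: (hq true).1|apply: (hq false).1].
rewrite measureU; [|exact: (hq true).1|exact: (hq false).1|].
  transitivity ((\prod_(i < n) weight (q' true i))%:E +
                (\prod_(i < n) weight (q' false i))%:E)%E.
    by congr (_ + _)%E; [exact: (hq true).2|exact: (hq false).2].
  rewrite -EFinD; congr EFin.
  rewrite (bigD1 j)//= [X in _ + X = _](bigD1 j)//= [RHS](bigD1 j)//=.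
  rewrite /q' eqxx qj /= mul1r.
  have e c : \prod_(i < n | i != j) weight (if i == j :> nat then Some c else q i)
      = \prod_(i < n | i != j) weight (q i).
    by apply: eq_bigr => i ij; rewrite val_eqE (negbTE ij).
  by rewrite !e -mulrDl addrC subrK mul1r.
apply/seteqP; split => // u [[_ h1] [_ h2]].
have := h1 j true (ltn_ord j); rewrite /q' eqxx => /(_ erefl).
by rewrite (h2 j false (ltn_ord j))// /q' eqxx.
Qed.

Let measurable_bit n : measurable_fun [set: R] (bit n).
Proof.
have ms : measurable_fun [set: R] shift.
  apply: measurable_fun_ifT.
  - exact: measurable_realfun.measurable_fun_ltr.
  - exact: measurable_realfun.measurable_funM.
  - by apply: measurable_realfun.measurable_funM => //; apply: measurable_realfun.measurable_funB.
apply: measurable_realfun.measurable_fun_ltr => //.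
elim: n => [|n IH]; first exact: measurable_id.
by apply: measurableT_comp.
Qed.

Let uniform : probability (measurableTypeR R) R :=
  mnormalize (mrestr lebesgue_measure (measurable_itv `[(0 : R), 1[)) point.

Let uniformE (U : set R) : uniform U = lebesgue_measure (U `&` `[0, 1[%classic).
Proof.
have h1 : lebesgue_measure (setT `&` `[(0 : R), 1[%classic) = 1%E.
  by rewrite setTI lebesgue_measure_itv /= lte_fin ltr01 sube0.
rewrite /uniform /= /mnormalize /mrestr.
case: ifPn => [|_].
  by case/orP => /eqP h; move: (etrans (esym h1) h) => // -[] /eqP;
    rewrite oner_eq0.
transitivity (lebesgue_measure (U `&` `[0%R, 1%R[%classic) * (fine 1)^-1%:E)%E.
  by congr (_ * (fine _)^-1%:E)%E; exact: h1.
by rewrite /= invr1 mule1.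
Qed.

Lemma bernoulli_percolation_exists (V : choiceType) (E : set (set V)) :
  countable E -> exists mu : probability (config E) R,
    bernoulli_percolation p mu.
Proof.
move=> /countable_injP[f f_inj].
pose X (u : measurableTypeR R) : config E := fun e => bit (f (\val e)) u.
have mX : measurable_fun [set: measurableTypeR R] X.
  apply: (@measurability _ _ (measurableTypeR R) (config E) _ X (range (@edge_open V E)) erefl).
  move=> _ [_ [e _ <-] <-]; rewrite setTI.
  rewrite (_ : X @^-1` _ = bit (f (\val e)) @^-1` [set true]).
    by rewrite -[_ @^-1` _]setTI; exact: measurable_bit.
  by apply/seteqP; split.
pose XF : {mfun measurableTypeR R >-> config E} := HB.pack X (isMeasurableFun.Build _ _ _ _ X mX).
pose mu : probability (config E) R := distribution uniform XF.
have muE (s : seq E) : uniq s ->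
    mu (\bigcap_(e in [set` s]) edge_open e) = (p ^+ size s)%:E.
  move=> us; pose t := [seq f (\val e) | e <- s].
  have ut : uniq t.
    rewrite map_inj_uniq// => e e' /f_inj h; apply: val_inj.
    by apply: h; exact: valP.
  pose q i := if i \in t then Some true else None.
  have [n tn] : exists n, forall i, i \in t -> (i < n)%N.
    exists (\max_(i <- t) i).+1 => i it.
    by rewrite ltnS; apply: leq_bigmax_seq.
  transitivity (uniform (X @^-1` (\bigcap_(e in [set` s]) edge_open e))) => //.
  rewrite uniformE.
  rewrite (_ : _ `&` _ = pattern n q); last first.
    apply/seteqP; split => u /=; rewrite in_itv /=.
      move=> [h u01]; split=> // i b _; rewrite /q; case: ifP => // it [<-].
      by move: it => /mapP[e es ->]; exact: h.
    move=> [u01 h]; split=> // e /= es.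
    have et : f (\val e) \in t by apply: map_f.
    by apply: (h _ true); [exact: tn|rewrite /q et].
  rewrite (mu_pattern n q).2; congr EFin.
  rewrite -(big_mkord xpredT (fun i => weight (q i))) /=.
  rewrite (bigID (mem t)) /= [X in _ * X]big1 ?mulr1; last first.
    by move=> i /negbTE it; rewrite /q it.
  rewrite (eq_bigr (fun=> p)); last by move=> i it; rewrite /q it.
  rewrite -big_filter (perm_big t); last first.
    apply: uniq_perm => //; first by rewrite filter_uniq// iota_uniq.
    move=> i; rewrite mem_filter mem_index_iota /=.
    by case: (boolP (i \in t)) => //= /tn.
  by rewrite big_const_seq count_predT iter_mulr_1 size_map.
have mu1 e : mu (edge_open e) = p%:E.
  have := muE [:: e] isT; rewrite expr1 => <-; congr (mu _).
  apply/seteqP; split => w h /=.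
    by move=> e' /=; rewrite inE => /eqP->.
  by apply: h => /=; rewrite inE.
exists mu; split=> // s us; rewrite muE//.
under eq_bigr do rewrite mu1.
by rewrite prodEFin big_const_seq count_predT iter_mulr_1.
Qed.

End BernoulliBits.


Lemma countable_generated (G : groupType) (S : set G) :
  finite_set S -> generates S -> countable [set: G].
Proof.
move=> /finite_set_countable/countable_injP[f f_inj] genS.
pose letter (x : bool * nat) : G :=
  let s := xget 1%g [set s | S s /\ f s = x.2] in
  if x.1 then s else s^-1%g.
pose word (l : seq (bool * nat)) : G := foldr (fun x g => letter x * g)%g 1%g l.
have word_cat l l' : word (l ++ l') = (word l * word l')%g.
  by elim: l => [|x l IH] /=; rewrite ?mul1g// IH mulgA.
have wordV l : exists l', word l' = (word l)^-1%g.
  elim: l => [|[b n] l [l' IH]]; first by exists [::]; rewrite /= invg1.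
  exists (l' ++ [:: (~~ b, n)]).
  rewrite word_cat IH /= mulg1 invgM; congr (_ * _)%g.
  by case: b; rewrite /letter /= ?invgK.
have : range word = setT.
  apply: genS.
    split=> [|x y]; first by apply/mem_set; exists [::].
    move=> /set_mem[l _ <-] /set_mem[l' _ <-].
    have [l2 h2] := wordV l'.
    by apply/mem_set; exists (l ++ l2) => //; rewrite word_cat h2.
  move=> s Ss; exists [:: (true, f s)] => //=; rewrite mulg1 /letter /=.
  case: xgetP => [x _ [Sx fx]|/(_ s)[]//].
  by apply: f_inj => //; exact: mem_set.
move=> <-; apply: sub_countable (countableP [set: seq (bool * nat)]).
exact: card_image_le.
Qed.

Lemma countable_cayley_edges (G : groupType) (S : set G) :
  finite_set S -> generates S -> countable (cayley_edges S).
Proof.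
move=> finS genS; have cG := countable_generated finS genS.
apply: (@sub_countable _ _ _ [set: G * G]); last first.
  by rewrite -setXTT; exact: countableX.
apply: card_le_trans (card_image_le (fun xy => [set xy.1; xy.2]) _).
apply: subset_card_le => e [x [s [_ _ ->]]].
by exists (x, (x * s)%g).
Qed.

(* An embedding of Gamma as a subgroup of a finitely generated group is
   represented by an injective homomorphism f, so that Gamma, as a set of
   vertices of the Cayley graph, is range f. *)
Definition obstacle_to_uniqueness (R : realType) (Gamma : groupType) : Prop :=
  forall (G : groupType) (S : set G), finite_set S -> generates S ->
  forall f : {multiplicative Gamma -> G}, injective f ->
  let A : set G := range f in
  ~ as_unique_infinite_cluster (cayley_edges S)
      (p_u (cayley_edges S) A : R) A.

(* Main.v *)
Require Import Defs.
From HB Require Import structures.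
From Stdlib Require Import Relations.
From mathcomp Require Import all_boot all_order all_algebra.
From mathcomp Require Import all_classical all_reals all_analysis.
From mathcomp Require Import measurable_realfun ring lra.

(** Let Gamma sit in the finitely generated group G, write K_A(w) for the set of
    vertices whose cluster in the configuration w meets A infinitely often, and
    say that p is good for A if almost surely K_A is a single cluster at level
    p. It suffices to see that p_u(Gamma) is good for Gamma only if
    p_u(H) = p_u(Gamma) and this level is good for H.

    Going down from Gamma to H keeps the level
    ([unique_infinite_cluster_subgroup]). The event that K_Gamma meets H
    infinitely often has positive probability, because all points of Gamma are
    equally likely to lie in K_Gamma, and it is invariant under the infinite
    group H. An event invariant under an infinite group of translations has
    probability 0 or 1 ([zero_one_law]), so K_Gamma is H-infinite.

    Going up from H to Gamma costs an arbitrarily small increase of the level.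
    Let p be good for H. Then K_gH = g K_H is a single cluster for every g, and
    L = {g in Gamma : K_gH = K_H almost surely} is a subgroup containing H. If L
    were not all of Gamma, there would be g in Gamma outside L with
    J = g L g^-1 /\ L infinite. Opening the edges of a path from K_H to K_gH
    merges the two clusters, so by insertion tolerance they coincide with
    positive probability; coincidence is a J-invariant event, hence almost sure,
    and g lies in L after all ([same_infinite_clusters_wq_normal]). So almost
    surely K_H is a cluster K that moves equivariantly under all of Gamma.

    Now open each closed edge independently with probability s > 0
    ([sprinkled_unique_infinite_cluster]). Suppose that a Gamma-infinite cluster
    C of the resulting configuration misses K, and let r + 1 be its distance to
    K. If infinitely many vertices of C are at distance r + 1, each of them has
    an edge leading to a vertex at distance r from K; given K, the cluster C is
    determined by the edges avoiding the r-neighbourhood of K, so these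
    infinitely many other edges would be independently closed, which is
    impossible ([infinite_frontier_null]). If only finitely many vertices of C
    are at distance r + 1, let every point of Gamma in C send unit mass to each
    of them: what is sent out is bounded, what is received is infinite, against
    the invariance under Gamma ([finite_frontier_null]). Hence every
    Gamma-infinite cluster contains K, and p + (1 - p) s is good for Gamma.

    It follows that p_u(Gamma) <= p for every p good for H
    ([as_unique_at_p_u_subgroup]). *)

Set Implicit Arguments.
Unset Strict Implicit.
Unset Printing Implicit Defensive.

Import Order.TTheory GRing.Theory Num.Theory.

Local Open Scope classical_set_scope.
Local Open Scope ring_scope.

(** * Measurable predicates and almost sure events *)

Section MeasurablePredicates.
Context d (T : measurableType d).
Implicit Types P Q : T -> Prop.

Lemma measurable_pred_not P :
  measurable [set t | P t] -> measurable [set t | ~ P t].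
Proof.
move=> mP; rewrite -[X in measurable X]/(~` [set t | P t]).
exact: measurableC.
Qed.

Lemma measurable_pred_and P Q : measurable [set t | P t] ->
  measurable [set t | Q t] -> measurable [set t | P t /\ Q t].
Proof. exact: measurableI. Qed.

Lemma measurable_pred_or P Q : measurable [set t | P t] ->
  measurable [set t | Q t] -> measurable [set t | P t \/ Q t].
Proof. exact: measurableU. Qed.

Lemma measurable_pred_imply P Q : measurable [set t | P t] ->
  measurable [set t | Q t] -> measurable [set t | P t -> Q t].
Proof.
move=> mP mQ; rewrite (_ : mkset _ = [set t | ~ P t \/ Q t]).
  by apply: measurable_pred_or => //; exact: measurable_pred_not.
apply/seteqP; split=> t /= h; last by case: h => [nP /nP|].
by have [/h|] := pselect (P t); [right|left].
Qed.

Lemma measurable_pred_Prop (P : Prop) : measurable [set t : T | P].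
Proof.
have [p|np] := pselect P.
  by rewrite (_ : mkset _ = setT) //; apply/seteqP; split.
by rewrite (_ : mkset _ = set0) //; apply/seteqP; split.
Qed.

Lemma measurable_pred_exists (I : Type) (P : I -> T -> Prop) :
  countable [set: I] -> (forall i, measurable [set t | P i t]) ->
  measurable [set t | exists i, P i t].
Proof.
move=> cI mP; rewrite (_ : mkset _ = \bigcup_i [set t | P i t]).
  exact: countable_bigcupT_measurable.
by apply/seteqP; split=> t [i]; [exists i|move=> _; exists i].
Qed.

Lemma measurable_pred_forall (I : Type) (P : I -> T -> Prop) :
  countable [set: I] -> (forall i, measurable [set t | P i t]) ->
  measurable [set t | forall i, P i t].
Proof.
move=> cI mP; rewrite (_ : mkset _ = [set t | ~ exists i, ~ P i t]).
  apply/measurable_pred_not/measurable_pred_exists => // i.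
  exact: measurable_pred_not.
apply/seteqP; split=> t /=; first by move=> h [i]; apply.
by move=> h i; apply: contrapT => hi; apply: h; exists i.
Qed.

Lemma measurable_pred_all_seq (I : eqType) (s : seq I) (P : I -> T -> Prop) :
  (forall i, measurable [set t | P i t]) ->
  measurable [set t | forall i, i \in s -> P i t].
Proof.
move=> mP; elim: s => [|i s IH].
  by rewrite (_ : mkset _ = setT) //; apply/seteqP; split.
rewrite (_ : mkset _ = [set t | P i t /\ forall j, j \in s -> P j t]).
  exact: measurable_pred_and.
apply/seteqP; split=> t /= h.
  by split=> [|j js]; apply: h; rewrite inE ?eqxx ?js ?orbT.
by move=> j; rewrite inE => /predU1P[->|]; [exact: h.1|exact: h.2].
Qed.

End MeasurablePredicates.

Lemma countable_seq (T : Type) : countable [set: T] -> countable [set: seq T].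
Proof. by move=> /Pcountable[T' ->]; exact: countableP. Qed.

Section AlmostSure.
Context d (T : measurableType d) (R : realType) (P : probability T R).

Lemma ae_exists (Q : T -> Prop) : {ae P, forall t, Q t} -> exists t, Q t.
Proof.
move=> aeQ; apply: contrapT => nQ.
have /(measure_negligible measurableT) h0 : P.-negligible [set: T].
  by apply: negligibleS aeQ => t _ /= Qt; apply: nQ; exists t.
have /esym/eqP := etrans (esym (probability_setT P)) h0.
by rewrite eq_sym onee_eq0.
Qed.

Lemma ae_forall_countable (I : Type) (Q : I -> T -> Prop) : countable [set: I] ->
  (forall i, {ae P, forall t, Q i t}) -> {ae P, forall t i, Q i t}.
Proof.
move=> cI; case: (Pcountable cI) => I' eI; case: _ / (esym eI) in Q cI *.
move=> h.
suff: {ae P, forall t n, if unpickle n is Some i then Q i t else True}.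
  by apply: filterS => t ht i; have := ht (pickle i); rewrite pickleK.
by apply: ae_foralln => n; case: unpickle => [i|]; [exact: h|exact: aeW].
Qed.

Lemma ae_eq1 (Q : T -> Prop) : measurable [set t | Q t] ->
  P [set t | Q t] = 1%E <-> {ae P, forall t, Q t}.
Proof.
move=> mQ; rewrite -[{ae _, _}]/(P.-negligible (~` [set t | Q t])).
rewrite negligibleP; last exact: measurableC.
rewrite -[X in _ <-> X = _]/(P (~` [set t | Q t])) probability_setC//.
split => [->|]; first by rewrite subee.
have := fin_num_measure P _ mQ.
case: (P _) => // r _ [] /eqP; rewrite subr_eq0 => /eqP<-//.
Qed.

Lemma ae_eq0P (Q : T -> Prop) : measurable [set t | Q t] ->
  P [set t | Q t] = 0%E <-> {ae P, forall t, ~ Q t}.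
Proof.
move=> mQ; rewrite -[{ae _, _}]/(P.-negligible (~` [set t | ~ Q t])).
rewrite (_ : ~` _ = [set t | Q t]) ?negligibleP//.
by apply/seteqP; split=> t /=; [move/contrapT|apply: contraPnot].
Qed.

(** The unions of the tails decrease to the upper limit, and each of them has
    probability at least [a]. *)
Lemma prob_limsup_ge (F : nat -> set T) (a : \bar R) :
  (forall n, measurable (F n)) -> (forall n, a <= P (F n))%E ->
  (a <= P (lim_sup_set F))%E.
Proof.
move=> mF aF.
have mU n : measurable (\bigcup_(k >= n) F k) by apply: bigcup_measurable.
have cvgF : P (\bigcup_(k >= n) F k) @[n --> \oo] --> P (lim_sup_set F).
  apply: lim_sup_set_cvg => //.
  exact: le_lt_trans (probability_le1 P (mU 0%N)) (ltry _).
rewrite -(cvg_lim _ cvgF)//; apply: lime_ge; first exact: cvgP cvgF.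
apply: nearW => n; apply: le_trans (aF n) _; apply: le_measure; rewrite ?inE//.
by apply: bigcup_sup => /=.
Qed.

(** The first Borel-Cantelli lemma, for expected counts bounded by [m]. *)
Lemma ae_finitely_often (F : nat -> set T) (m : nat) :
  (forall n, measurable (F n)) ->
  (forall n, (\sum_(i < n) P (F i) <= m%:R%:E)%E) ->
  {ae P, forall t, ~ lim_sup_set F t}.
Proof.
move=> mF hF; apply/ae_eq0P.
  apply: bigcap_measurable => // n _; exact: bigcup_measurable.
apply: lim_sup_set_cvg0 => //.
apply: (@le_lt_trans _ _ (m%:R%:E)); last exact: ltry.
apply: lime_le; first by apply: is_cvg_nneseries.
by apply: nearW => n; rewrite big_mkord.
Qed.

Lemma sum_prob_le (F : nat -> set T) (m n : nat) :
  (forall n, measurable (F n)) ->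
  (forall t, (\sum_(i < n) (t \in F i) <= m)%N) ->
  (\sum_(i < n) P (F i) <= m%:R%:E)%E.
Proof.
move=> mF hF.
have -> : (\sum_(i < n) P (F i) = \int[P]_t \sum_(i < n) (\1_(F i) t)%:E)%E.
  rewrite ge0_integral_sum//.
  - by apply: eq_bigr => i _; rewrite integral_indic// setIT.
  - by move=> i; apply/measurable_EFinP; exact: measurable_indic.
rewrite -[leRHS]mule1 -(probability_setT P) -integral_cst//.
apply: ge0_le_integral => //.
- by move=> t _; apply: sume_ge0 => i _.
- by apply: emeasurable_sum => i; apply/measurable_EFinP; exact: measurable_indic.
- move=> t _; rewrite sumEFin lee_fin; under eq_bigr do rewrite indicE.
  by rewrite -natr_sum ler_nat.
Qed.

End AlmostSure.

(** * Bernoulli percolation: uniqueness of the law, sprinkling, insertion *)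

Section IndependentBits.
Context d (T : measurableType d) (R : realType) (P : probability T R).

(** Inclusion-exclusion, one complemented event at a time: the induction needs
    the mixed events in which some bits are set and others are not. *)
Lemma independent_compl (I : eqType) (A : I -> T -> Prop) (p : R) :
  (forall i, measurable [set t | A i t]) ->
  (forall s, uniq s ->
     P [set t | forall i, i \in s -> A i t] = (p ^+ size s)%:E) ->
  forall s, uniq s ->
     P [set t | forall i, i \in s -> ~ A i t] = ((1 - p) ^+ size s)%:E.
Proof.
move=> mA hA s us.
pose ev (s1 s2 : seq I) := [set t |
  (forall i, i \in s1 -> A i t) /\ (forall i, i \in s2 -> ~ A i t)].
have mev s1 s2 : measurable (ev s1 s2).
  apply: measurable_pred_and.
    exact: (measurable_pred_all_seq (P := A) s1 mA).
  apply: (measurable_pred_all_seq (P := fun i t => ~ A i t) s2) => i.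
  exact: measurable_pred_not.
suff {s us} key s2 : forall s1, uniq (s1 ++ s2) ->
    P (ev s1 s2) = (p ^+ size s1 * (1 - p) ^+ size s2)%:E.
  have := key s [::]; rewrite expr0 mul1r => <-//; congr (P _).
  by apply/seteqP; split=> t; [move=> h; split|case].
elim: s2 => [|i s2 IH] s1.
  rewrite cats0 => us1; rewrite expr0 mulr1 -hA//; congr (P _).
  by apply/seteqP; split=> t; [case|move=> h; split].
move=> us; have us' : uniq ((i :: s1) ++ s2).
  by rewrite -(perm_uniq (permEl (perm_catCA s1 [:: i] s2))).
have -> : ev s1 (i :: s2) = ev s1 s2 `\` ev (i :: s1) s2.
  apply/seteqP; split=> t.
    move=> [h1 h2]; split.
      by split=> // j js; apply: h2; rewrite inE js orbT.
    by move=> [/(_ i (mem_head _ _)) hi _]; apply: (h2 i (mem_head _ _)).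
  move=> [[h1 h2] h3]; split=> // j; rewrite inE => /predU1P[->|/h2//] hi.
  by apply: h3; split=> // k; rewrite inE => /predU1P[->|/h1].
transitivity (P (ev s1 s2) - P (ev (i :: s1) s2))%E.
  rewrite measureD//; last by rewrite -ge0_fin_numE ?fin_num_measure.
  rewrite setIidr//.
  by move=> t [h1 h2]; split=> // j js; apply: h1; rewrite inE js orbT.
rewrite IH; last by move: us'; rewrite /= => /andP[].
rewrite IH// -EFinB; congr EFin => /=; rewrite !exprS; lra.
Qed.

End IndependentBits.

Lemma injective_leaves_seq (T : eqType) (h : nat -> T) (s : seq T) :
  injective h -> exists N, forall n, (N <= n)%N -> h n \notin s.
Proof.
move=> hinj; elim: s => [|v s [N hN]]; first by exists 0%N.
have [[m hm]|nm] := pselect (exists m, h m = v).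
  exists (maxn N m.+1) => n; rewrite geq_max inE negb_or => /andP[/hN -> mn].
  by rewrite andbT; apply/eqP => hn; move: mn; rewrite (hinj n m) ?ltnn// hn hm.
exists N => n /hN; rewrite inE negb_or => ->; rewrite andbT.
by apply/eqP => hn; apply: nm; exists n.
Qed.

Lemma infinite_enum (T : Type) (D : set T) : infinite_set D ->
  exists2 g : nat -> T, injective g & forall n, D (g n).
Proof.
elim/Ppointed: T => T in D *.
  by move=> /infinite_setN0[x]; have : [set: T] x by []; rewrite empty_eq0.
move=> /infiniteP/pcard_leP/unsquash g; exists g.
  by move=> x y; apply: inj; rewrite inE.
by move=> n; apply: (@funS _ _ _ _ g).
Qed.

Section Bernoulli.
Context (V : choiceType) (E : set (set V)) (R : realType).
Implicit Types (p : R) (s : seq E).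

Definition all_open s : set (config E) := [set w | forall e, e \in s -> w e].

Lemma measurable_edge (e : E) : measurable [set w : config E | w e].
Proof. by apply: sub_sigma_algebra; exists e. Qed.

Lemma all_openE s : all_open s = \bigcap_(e in [set` s]) edge_open e.
Proof. by apply/seteqP; split=> w h e /=; apply: h. Qed.

Lemma measurable_all_open s : measurable (all_open s).
Proof.
exact: (measurable_pred_all_seq s measurable_edge).
Qed.

Lemma bernoulli_all_open p (mu : probability (config E) R) s :
  bernoulli_percolation p mu -> uniq s -> mu (all_open s) = (p ^+ size s)%:E.
Proof.
move=> [mu1 mui] us; rewrite all_openE mui//; under eq_bigr do rewrite mu1.
by rewrite prodEFin big_const_seq count_predT iter_mulr_1.
Qed.

Lemma bernoulli_of_all_open p (mu : probability (config E) R) :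
  (forall s, uniq s -> mu (all_open s) = (p ^+ size s)%:E) ->
  bernoulli_percolation p mu.
Proof.
move=> h; have h1 e : mu (edge_open e) = p%:E.
  rewrite -[p in RHS]expr1 -(h [:: e])//; congr (mu _).
  apply/seteqP; split=> w /=; first by move=> we e'; rewrite inE => /eqP->.
  by apply; rewrite mem_head.
split=> // s us; rewrite -all_openE h//; under eq_bigr do rewrite h1.
by rewrite prodEFin big_const_seq count_predT iter_mulr_1.
Qed.

Lemma all_open_pi : setI_closed (range all_open).
Proof.
move=> _ _ [s _ <-] [t _ <-]; exists (s ++ t) => //.
apply/seteqP; split=> w /=.
  by move=> h; split=> e es; apply: h; rewrite mem_cat es ?orbT.
by move=> [h1 h2] e; rewrite mem_cat => /orP[/h1|/h2].
Qed.

Lemma measurable_all_openE : @measurable _ (config E) = <<s range all_open >>.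
Proof.
apply/seteqP; split=> [A|].
  apply: smallest_sub; first exact: smallest_sigma_algebra.
  move=> _ [e _ <-]; apply: sub_sigma_algebra; exists [:: e] => //.
  apply/seteqP; split=> w /=; first by apply; rewrite mem_head.
  by move=> we e'; rewrite inE => /eqP->.
apply: smallest_sub; first exact: sigma_algebra_measurable.
by move=> _ [s _ <-]; exact: measurable_all_open.
Qed.

Lemma bernoulli_unique p (mu nu : probability (config E) R) A :
  bernoulli_percolation p mu -> bernoulli_percolation p nu ->
  measurable A -> mu A = nu A.
Proof.
move=> hmu hnu; apply: (measure_unique (range all_open) (fun=> setT)).
- exact: measurable_all_openE.
- exact: all_open_pi.
- by move=> _; exists [::] => //; apply/seteqP; split.
- exact: bigcup_const.
- move=> _ [s _ <-].
  have all_open_undup : all_open s = all_open (undup s).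
    by apply/seteqP; split=> w h e; have := h e; rewrite mem_undup.
  rewrite all_open_undup; have us := undup_uniq s.
  exact: etrans (bernoulli_all_open hmu us) (esym (bernoulli_all_open hnu us)).
- by move=> _; rewrite (le_lt_trans (probability_le1 mu measurableT)) ?ltry.
Qed.

Lemma measurable_to_config d (T : measurableType d) (f : T -> config E) :
  (forall e, measurable [set t | f t e]) -> measurable_fun [set: T] f.
Proof.
move=> mf.
apply: (@measurability _ _ T (config E) _ f (range (@edge_open V E)) erefl).
by move=> _ [_ [e _ <-] <-]; rewrite setTI; exact: mf.
Qed.

Lemma measurable_config_preimage d (T : measurableType d) (f : T -> config E) A :
  (forall e, measurable [set t | f t e]) -> measurable A -> measurable (f @^-1` A).
Proof.
by move=> mf mA; rewrite -[X in measurable X]setTI; exact: (measurable_to_config mf).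
Qed.

Section Image.
Context d (T : measurableType d) (P : probability T R) (f : T -> config E).
Hypothesis mf : forall e, measurable [set t | f t e].

Lemma bernoulli_image p :
  (forall s, uniq s -> P (f @^-1` all_open s) = (p ^+ size s)%:E) ->
  exists2 nu : probability (config E) R, bernoulli_percolation p nu &
    forall A, nu A = P (f @^-1` A).
Proof.
move=> hP; pose F : {mfun T >-> config E} :=
  HB.pack f (isMeasurableFun.Build _ _ _ _ f (measurable_to_config mf)).
by exists (distribution P F) => //; apply: bernoulli_of_all_open.
Qed.

(** The law is determined by the events [all_open s], so a random configuration
    has it as soon as these events have the right probabilities. *)
Lemma bernoulli_preimage p (mu : probability (config E) R) A :
  (forall s, uniq s -> P (f @^-1` all_open s) = (p ^+ size s)%:E) ->
  bernoulli_percolation p mu -> measurable A -> P (f @^-1` A) = mu A.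
Proof.
move=> /bernoulli_image[nu hnu nuE] hmu mA.
by rewrite -nuE; exact: (bernoulli_unique hnu hmu).
Qed.

End Image.

Definition all_closed s : set (config E) := [set w | forall e, e \in s -> ~ w e].

Lemma bernoulli_all_closed p (mu : probability (config E) R) s :
  bernoulli_percolation p mu -> uniq s ->
  mu (all_closed s) = ((1 - p) ^+ size s)%:E.
Proof.
move=> hmu; move: s.
apply: (independent_compl (A := fun e w => is_true ((w : config E) e))).
  by move=> e; exact: measurable_edge.
by move=> s us; exact: bernoulli_all_open.
Qed.

(** The variant with closed edges is the convenient one for a union of
    configurations, whose closed edges are closed in both. *)
Lemma bernoulli_preimage_closed d (T : measurableType d) (P : probability T R)
    (f : T -> config E) p (mu : probability (config E) R) A :
  (forall e, measurable [set t | f t e]) ->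
  (forall s, uniq s -> P (f @^-1` all_closed s) = ((1 - p) ^+ size s)%:E) ->
  bernoulli_percolation p mu -> measurable A -> P (f @^-1` A) = mu A.
Proof.
move=> mf hP hmu mA; apply: bernoulli_preimage hmu mA => // s us.
have := @independent_compl _ _ _ P _ (fun e t => ~ f t e) (1 - p) _ hP s us.
rewrite opprB addrC subrK => <-.
  congr (P _); apply/seteqP; split=> t h e es; first by move=> /(_ (h e es)).
  by apply: contrapT => ne; apply: (h e es).
by move=> e; exact/measurable_pred_not.
Qed.

Section ProductPredicates.
Context d1 d2 (T1 : measurableType d1) (T2 : measurableType d2).

Lemma measurable_pred_fst (Q : T1 -> Prop) : measurable [set x | Q x] ->
  measurable [set t : T1 * T2 | Q t.1].
Proof.
by move=> mQ; rewrite -[X in measurable X]setTI; apply: measurable_fst.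
Qed.

Lemma measurable_pred_snd (Q : T2 -> Prop) : measurable [set x | Q x] ->
  measurable [set t : T1 * T2 | Q t.2].
Proof.
by move=> mQ; rewrite -[X in measurable X]setTI; apply: measurable_snd.
Qed.

End ProductPredicates.

Definition union_config (t : config E * config E) : config E :=
  fun e => t.1 e || t.2 e.

Lemma measurable_union_config e :
  measurable [set t : config E * config E | union_config t e].
Proof.
rewrite (_ : mkset _ = [set t : config E * config E | t.1 e \/ t.2 e]).
  apply: measurable_pred_or.
    exact: (measurable_pred_fst (measurable_edge e)).
  exact: (measurable_pred_snd (measurable_edge e)).
by apply/seteqP; split=> t /orP.
Qed.

Lemma measurable_all_closed s : measurable (all_closed s).
Proof.
apply: (measurable_pred_all_seq (P := fun e (w : config E) => ~ w e) s) => e.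
exact: measurable_pred_not (measurable_edge e).
Qed.

Lemma bernoulli_sprinkle p q (mu nu la : probability (config E) R) A :
  bernoulli_percolation p mu -> bernoulli_percolation q nu ->
  bernoulli_percolation (p + (1 - p) * q) la -> measurable A ->
  (mu \x nu)%E (union_config @^-1` A) = la A.
Proof.
move=> hmu hnu hla mA.
apply: (bernoulli_preimage_closed (P := (mu \x nu)%E) measurable_union_config
  _ hla mA) => s us.
have -> : union_config @^-1` all_closed s = all_closed s `*` all_closed s.
  apply/seteqP; split=> t /=.
    by move=> h; split=> e es te; apply: (h e es); rewrite /union_config te ?orbT.
  by move=> [h1 h2] e es /orP[/(h1 e es)|/(h2 e es)].
transitivity (mu (all_closed s) * nu (all_closed s))%E.
  by apply: product_measure1E; exact: measurable_all_closed.
rewrite (bernoulli_all_closed hmu us) (bernoulli_all_closed hnu us) -EFinM.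
congr EFin; rewrite -exprMn; congr (_ ^+ _); lra.
Qed.

Definition splice (F : E -> bool) (t : config E * config E) : config E :=
  fun e => if F e then t.1 e else t.2 e.

Lemma measurable_splice F e :
  measurable [set t : config E * config E | splice F t e].
Proof.
rewrite /splice; case: (F e).
  exact: (measurable_pred_fst (measurable_edge e)).
exact: (measurable_pred_snd (measurable_edge e)).
Qed.

(** Independent halves of two samples form one sample. This is how independence
    of the edges in [F] from the others is put to work by Fubini's theorem. *)
Lemma bernoulli_splice p (mu : probability (config E) R) F A :
  bernoulli_percolation p mu -> measurable A ->
  (mu \x mu)%E (splice F @^-1` A) = mu A.
Proof.
move=> hmu mA.
apply: (bernoulli_preimage (P := (mu \x mu)%E) (measurable_splice F) _ hmu mA).
move=> s us.
have -> : splice F @^-1` all_open s =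
    all_open (seq.filter F s) `*` all_open (seq.filter (predC F) s).
  apply/seteqP; split=> t /=.
    move=> h; split=> e; rewrite mem_filter /= => /andP[Fe es];
      by have := h e es; rewrite /splice ?Fe ?(negbTE Fe).
  move=> [h1 h2] e es; rewrite /splice; case: ifPn => Fe.
    by apply: h1; rewrite mem_filter Fe.
  by apply: h2; rewrite mem_filter /= Fe.
transitivity (mu (all_open (seq.filter F s)) *
              mu (all_open (seq.filter (predC F) s)))%E.
  by apply: product_measure1E; exact: measurable_all_open.
rewrite !(bernoulli_all_open hmu) ?filter_uniq// -EFinM -exprD.
by rewrite !size_filter count_predC.
Qed.

Definition relabel (h : E -> E) (w : config E) : config E := fun e => w (h e).

Lemma measurable_relabel h e : measurable [set w | relabel h w e].
Proof. exact: measurable_edge. Qed.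

Lemma bernoulli_relabel p (mu : probability (config E) R) (h : E -> E) A :
  injective h -> bernoulli_percolation p mu -> measurable A ->
  mu (relabel h @^-1` A) = mu A.
Proof.
move=> hinj hmu mA.
apply: (bernoulli_preimage (measurable_relabel h) _ hmu mA) => s us.
rewrite (_ : _ @^-1` _ = all_open (map h s)).
  by rewrite (bernoulli_all_open hmu) ?map_inj_uniq// size_map.
apply/seteqP; split=> w /= H e; first by move=> /mapP[e' es ->]; exact: H.
by move=> es; apply: H; exact: map_f.
Qed.

Lemma bernoulli_le1 p (mu : probability (config E) R) (e : E) :
  bernoulli_percolation p mu -> 0 <= p <= 1.
Proof.
move=> [h _]; rewrite -!lee_fin -(h e) measure_ge0 probability_le1//.
exact: measurable_edge.
Qed.

Lemma product_null d1 d2 (T1 : measurableType d1) (T2 : measurableType d2)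
    (P : probability T1 R) (Q : probability T2 R) (A : set (T1 * T2)) :
  measurable A -> (forall x, Q [set y | A (x, y)] = 0%E) -> (P \x Q)%E A = 0%E.
Proof.
move=> mA h; rewrite /product_measure1; apply: integral0_eq => x _ /=.
by rewrite -[RHS](h x); congr (Q _); apply/seteqP; split=> y /xsectionP.
Qed.

Lemma product_null_ae d1 d2 (T1 : measurableType d1) (T2 : measurableType d2)
    (P : probability T1 R) (Q : probability T2 R) (A : set (T1 * T2)) :
  measurable A -> (P \x Q)%E A = 0%E ->
  {ae P, forall x, Q [set y | A (x, y)] = 0%E}.
Proof.
move=> mA; rewrite /product_measure1 => h.
have : (\int[P]_(x in setT) `|(Q \o xsection A) x| = 0)%E.
  by rewrite -[RHS]h; apply: eq_integral => x _; rewrite gee0_abs.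
move/ae_eq_integral_abs => /(_ measurableT (measurable_fun_xsection Q mA)).
apply: filterS => x /(_ I) /= <-.
by congr (Q _); apply/seteqP; split=> y /xsectionP.
Qed.

Definition insert_edges (F : seq E) (w : config E) : config E :=
  fun e => (e \in F) || w e.

(** Resample the edges of [F]: they come out all open with positive probability,
    independently of the rest, and the outcome is then [insert_edges F w]. *)
Lemma insertion_tolerance p (mu : probability (config E) R) F (Q : config E -> Prop) :
  bernoulli_percolation p mu -> 0 < p -> measurable [set w | Q w] ->
  {ae mu, forall w, Q w} -> {ae mu, forall w, Q (insert_edges F w)}.
Proof.
move=> hmu p0 mQ aeQ; pose A : set (config E) := [set w | ~ Q w].
have mA : measurable A by exact: measurable_pred_not.
have A0 : mu A = 0%E by apply/ae_eq0P => //; apply: filterS aeQ => w Qw; apply.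
pose g := splice (fun e => e \notin F).
have mgA : measurable (g @^-1` A).
  exact: (measurable_config_preimage (measurable_splice _)).
have := product_null_ae mgA (etrans (bernoulli_splice _ hmu mA) A0).
apply: filterS => w /= h; apply: contrapT => nQ.
suff : (mu (all_open (undup F)) <= 0)%E.
  rewrite (bernoulli_all_open hmu) ?undup_uniq// lee_fin.
  by rewrite leNgt exprn_gt0.
rewrite -h; apply: le_measure; rewrite ?inE.
- exact: measurable_all_open.
- rewrite (_ : mkset _ = xsection (g @^-1` A) w); first exact: measurable_xsection.
  by apply/seteqP; split=> x; rewrite xsectionE.
move=> w' w'F; rewrite /= /A /=; rewrite (_ : g _ = insert_edges F w)//.
apply/funext => e; rewrite /g /splice /insert_edges /=.
by case: ifPn => [/negbTE->//|/negPn eF]; rewrite eF w'F// mem_undup.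
Qed.

(** [n] of these edges are closed together with probability [(1 - p) ^+ n]. *)
Lemma infinite_not_all_closed p (mu : probability (config E) R) (D : set E) :
  bernoulli_percolation p mu -> 0 < p -> infinite_set D ->
  {ae mu, forall w, ~ forall e, D e -> ~ (w : config E) e}.
Proof.
move=> hmu p0 /infinite_enum[g ginj gD].
have /andP[_ p1] := bernoulli_le1 (g 0%N) hmu.
pose s n := [seq g i | i <- iota 0 n].
pose N := \bigcap_n all_closed (s n).
have mN : measurable N by apply: bigcapT_measurable => n; exact: measurable_all_closed.
have hN n : (mu N <= ((1 - p) ^+ n)%:E)%E.
  have us : uniq (s n) by rewrite map_inj_uniq ?iota_uniq.
  rewrite -[n in leRHS](size_iota 0) -(size_map g) -(bernoulli_all_closed hmu us).
  apply: le_measure; rewrite ?inE//; first exact: measurable_all_closed.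
  exact: bigcap_inf.
exists N; split=> //.
  apply/eqP; rewrite eq_le measure_ge0 andbT.
  have : ((1 - p) ^+ n)%:E @[n --> \oo] --> 0%:E.
    apply: cvg_EFin; first exact: nearW.
    by apply: cvg_expr; rewrite ger0_norm; lra.
  move=> h; rewrite -[leRHS]/(0%:E) -(cvg_lim _ h)//.
  apply: lime_ge; first exact: cvgP h.
  exact: nearW.
move=> w /= /contrapT h n _ e /mapP[i _ ->]; exact/h/gD.
Qed.

End Bernoulli.

(** * The zero-one law for translation-invariant events *)

Section ZeroOne.
Context (V : choiceType) (E : set (set V)) (R : realType).
Context (p : R) (mu : probability (config E) R).
Hypothesis hmu : bernoulli_percolation p mu.

Definition finitary (B : set (config E)) : Prop :=
  measurable B /\ exists s : seq E, forall w w' : config E,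
    (forall e, e \in s -> w e = w' e) -> B w -> B w'.

Let sd (A B : set (config E)) := (A `\` B) `|` (B `\` A).

Let sd_sub A B : A `<=` B `|` sd A B.
Proof. by move=> w Aw; have [Bw|nBw] := pselect (B w); [left|right; left]. Qed.

Let sdC A B : sd A B = sd B A.
Proof. by rewrite /sd setUC. Qed.

Let msd A B : measurable A -> measurable B -> measurable (sd A B).
Proof. by move=> mA mB; apply: measurableU; exact: measurableD. Qed.

Let le_mu2 X A B : measurable X -> measurable A -> measurable B ->
  X `<=` A `|` B -> (mu X <= mu A + mu B)%E.
Proof.
move=> mX mA mB XAB; apply: le_trans (measureU2 mu mA mB).
by apply: le_measure; rewrite ?inE//; exact: measurableU.
Qed.

(** The events that can be approximated form a lambda-system containing the
    generating pi-system. *)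
Lemma finitary_approximation A : measurable A -> forall eps : R, 0 < eps ->
  exists2 B, finitary B & (mu (sd A B) <= eps%:E)%E.
Proof.
pose L := [set A | measurable A /\ forall eps : R, 0 < eps ->
  exists2 B, finitary B & (mu (sd A B) <= eps%:E)%E].
suff sub : @measurable _ (config E) `<=` L by move=> /sub[].
clear A.
rewrite measurable_all_openE.
have finD B B' : finitary B -> finitary B' -> finitary (B `\` B').
  move=> [mB [s hs]] [mB' [s' hs']]; split; first exact: measurableD.
  exists (s ++ s') => w w' h [Bw B'w]; split.
    by apply: hs Bw => e es; apply: h; rewrite mem_cat es.
  by move=> B'w'; apply: B'w; apply: hs' B'w' => e es; rewrite h// mem_cat es orbT.
apply: lambda_system_subset; [exact: all_open_pi| |
  |by []].
- split=> //.
  + split=> // eps eps0; exists setT.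
      by split=> //; exists [::].
    by rewrite /sd setDv setU0 measure0 lee_fin ltW.
  + move=> A B BA [mA hA] [mB hB]; split; first exact: measurableD.
    move=> eps eps0; have eps20 : 0 < eps / 2 by lra.
    have [A' fA' hA'] := hA _ eps20; have [B' fB' hB'] := hB _ eps20.
    have mA' := fA'.1; have mB' := fB'.1.
    exists (A' `\` B'); first exact: finD.
    apply: le_trans (_ : (mu (sd A A') + mu (sd B B') <= _)%E).
      apply: le_mu2; [|exact: msd|exact: msd|].
        by apply: msd; exact: measurableD.
      move=> w; rewrite /sd /=.
      have [|] := pselect (A w); have [|] := pselect (B w);
      have [|] := pselect (A' w); have [|] := pselect (B' w); tauto.
    by rewrite [eps]splitr EFinD leeD.
  + move=> F ndF hF; have mF n := (hF n).1.
    have mU : measurable (\bigcup_n F n) by exact: bigcupT_measurable.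
    split=> // eps eps0; have eps20 : 0 < eps / 2 by lra.
    have [n hn] : exists n, (mu (\bigcup_n F n `\` F n) <= (eps / 2)%:E)%E.
      apply: contrapT => hn.
      have h n : (mu (F n) <= mu (\bigcup_n F n) - (eps / 2)%:E)%E.
        have : ((eps / 2)%:E <= mu (\bigcup_n F n `\` F n))%E.
          by rewrite leNgt; apply/negP => /ltW h; apply: hn; exists n.
        have -> : mu (\bigcup_n F n `\` F n) = (mu (\bigcup_n F n) - mu (F n))%E.
          rewrite measureD//; last by rewrite -ge0_fin_numE ?fin_num_measure.
          by rewrite setIidr//; exact: bigcup_sup.
        rewrite -(fineK (fin_num_measure mu _ (mF n))).
        rewrite -(fineK (fin_num_measure mu _ mU)).
        by rewrite -!EFinB !lee_fin; lra.
      have cv := nondecreasing_cvg_mu (mu := mu) mF mU ndF.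
      have : (mu (\bigcup_n F n) <= mu (\bigcup_n F n) - (eps / 2)%:E)%E.
        rewrite -[leLHS](cvg_lim _ cv)//; apply: lime_le; first exact: cvgP cv.
        exact: nearW.
      rewrite -(fineK (fin_num_measure mu _ mU)) -!EFinB !lee_fin; lra.
    have [B fB hB] := (hF n).2 _ eps20; have mB := fB.1.
    exists B => //.
    apply: le_trans (_ : (mu (\bigcup_n F n `\` F n) + mu (sd (F n) B) <= _)%E).
      apply: le_mu2; [exact: msd|exact: measurableD|exact: msd|].
      move=> w; rewrite /sd /=.
      have : F n w -> (\bigcup_n F n) w by move=> ?; exists n.
      have [|] := pselect (F n w); have [|] := pselect (B w);
      have [|] := pselect ((\bigcup_n F n) w); tauto.
    by rewrite [eps]splitr EFinD leeD.
- move=> _ [s _ <-]; split; first exact: measurable_all_open.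
  move=> eps eps0; exists (all_open s).
    split; first exact: measurable_all_open.
    by exists s => w w' h ws e es; rewrite -h// ws.
  by rewrite /sd setDv setU0 measure0 lee_fin ltW.
Qed.

(** Approximate [A] by a finitary event [B] and move [B] by some [h n] to a
    disjoint set of edges. Both [B] and its translate are close to [A], by
    invariance, and they are independent, so [mu A] is close to [mu A ^+ 2]. *)
Lemma zero_one_law (h : nat -> E -> E) (A : set (config E)) :
  (forall n, injective (h n)) ->
  (forall e e', exists N, forall n, (N <= n)%N -> h n e <> e') ->
  measurable A -> (forall n, relabel (h n) @^-1` A = A) ->
  (0 < mu A)%E -> mu A = 1%E.
Proof.
move=> hinj hfar mA Ainv A0.
have key (eps : R) : 0 < eps -> exists b : R,
   fine (mu A) <= b ^+ 2 + 2 * eps /\ b <= fine (mu A) + eps /\ 0 <= b.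
  move=> eps0; have [B [mB [s hs]] hB] := finitary_approximation mA eps0.
  have [n hn] : exists n, forall e e', e \in s -> e' \in s -> h n e <> e'.
    have [N hN] : exists N, forall e e', e \in s -> e' \in s ->
        forall n, (N <= n)%N -> h n e <> e'.
      have : exists N, forall x, x \in [seq (e, e') | e <- s, e' <- s] ->
          forall n, (N <= n)%N -> h n x.1 <> x.2.
        elim: [seq _ | _ <- _, _ <- _] => [|x l [N IH]]; first by exists 0%N.
        have [N' hN'] := hfar x.1 x.2; exists (maxn N N') => y.
        rewrite inE => /predU1P[->|yl] n; rewrite geq_max => /andP[h1 h2].
          exact: hN'.
        exact: IH.
      move=> [N hN]; exists N => e e' es e's.
      by apply: (hN (e, e')); apply/allpairsP; exists (e, e').
    by exists N => e e' es e's; exact: hN.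
  pose B' := relabel (h n) @^-1` B.
  have mB' : measurable B'.
    exact: (measurable_config_preimage (measurable_relabel (h n))).
  have muB' : mu B' = mu B by exact: (bernoulli_relabel (@hinj n) hmu).
  have hB' : (mu (sd A B') <= eps%:E)%E.
    have -> : sd A B' = relabel (h n) @^-1` (sd A B) by rewrite /sd -{1 2}(Ainv n).
    by rewrite (bernoulli_relabel (@hinj n) hmu)//; exact: msd.
  have muBB' : mu (B `&` B') = (mu B * mu B)%E.
    rewrite -(bernoulli_splice (mem_seq s) hmu); last exact: measurableI.
    have -> : splice (mem_seq s) @^-1` (B `&` B') = B `*` B'.
      have g1 t e : e \in s -> splice (mem_seq s) t e = t.1 e.
        by move=> es; rewrite /splice [mem_seq s e]es.
      have g2 t e : e \in s ->
          relabel (h n) (splice (mem_seq s) t) e = relabel (h n) t.2 e.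
        move=> es; rewrite /relabel /splice; case: ifPn => // hes.
        by have := hn _ _ es hes.
      apply/seteqP; split=> t /= [h1 h2]; split.
      - by apply: hs h1 => e es; rewrite g1.
      - by apply: hs h2 => e es; rewrite g2.
      - by apply: hs h1 => e es; rewrite g1.
      - by apply: hs h2 => e es; rewrite g2.
    transitivity (mu B * mu B')%E; last by rewrite muB'.
    exact: product_measure1E.
  exists (fine (mu B)).
  have h1 : (mu A <= mu (B `&` B') + mu (sd A B `|` sd A B'))%E.
    apply: le_mu2 => //; [exact: measurableI|by apply: measurableU; exact: msd|].
    move=> w; rewrite /sd /=.
    have [|] := pselect (A w); have [|] := pselect (B w);
      have [|] := pselect (B' w); tauto.
  have h2 : (mu (sd A B `|` sd A B') <= eps%:E + eps%:E)%E.
    apply: le_trans (measureU2 mu (msd mA mB) (msd mA mB')) _; exact: leeD.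
  have h3 : (mu B <= mu A + mu (sd A B))%E.
    by apply: le_mu2 => //; [exact: msd|rewrite sdC; exact: sd_sub].
  have fA := fin_num_measure mu _ mA; have fB := fin_num_measure mu _ mB.
  have h4 : (mu A <= mu B * mu B + (eps%:E + eps%:E))%E.
    by apply: le_trans h1 _; rewrite muBB' leeD2l.
  have h5 : (mu B <= mu A + eps%:E)%E by apply: le_trans h3 _; rewrite leeD2l.
  move: h4 h5; rewrite -(fineK fA) -(fineK fB) -!EFinM -!EFinD !lee_fin /=.
  move=> h4 h5.
  by split; [rewrite expr2; lra|split=> //; exact/fine_ge0/measure_ge0].
have fA := fin_num_measure mu _ mA.
move: key A0 (probability_le1 mu mA); rewrite -(fineK fA) /= lte_fin lee_fin.
set a := fine _ => key a0 a1; congr EFin; apply/eqP; rewrite eq_le a1 /=.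
rewrite leNgt; apply/negP => a_lt1.
(* Call this number d. The estimates for eps = d give a <= a ^+ 2 + 5 * d, while
   a - a ^+ 2 = 6 * d. *)
have d0 : 0 < a * (1 - a) / 6.
  by apply: divr_gt0 => //; apply: mulr_gt0 => //; lra.
have [b [hb1 [hb2 b0]]] := key _ d0.
set d := a * (1 - a) / 6 in d0 hb1 hb2.
have dE : a * (1 - a) = 6 * d by rewrite /d; lra.
have d1 : d <= 1 by nra.
have : b ^+ 2 <= (a + d) ^+ 2 by rewrite ler_sqr ?nnegrE//; lra.
have : (a + d) ^+ 2 <= a ^+ 2 + 3 * d by rewrite !expr2; nra.
rewrite expr2 => *; nra.
Qed.

End ZeroOne.

(** * Clusters *)

Section Clusters.
Context (V : choiceType) (E : set (set V)).
Implicit Types (w : config E) (x y z : V) (A B : set V).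

Definition joined w x y := clos_refl_trans V (open_adjacent w) x y.

Definition meets_infinitely A w x := infinite_set (cluster_of w x `&` A).

Lemma joined_refl w x : joined w x x. Proof. exact: rt_refl. Qed.

Lemma joined_trans w y x z :
  joined w x y -> joined w y z -> joined w x z.
Proof. exact: rt_trans. Qed.

Lemma open_adjacent_sym w x y : open_adjacent w x y -> open_adjacent w y x.
Proof. by move=> [e we ee]; exists e; rewrite // ee setUC. Qed.

Lemma joined_sym w x y : joined w x y -> joined w y x.
Proof.
elim=> [{}x {}y|{}x|{}x {}y z _ yx _ zy]; first 1 last.
- exact: joined_refl.
- exact: joined_trans zy yx.
- by move/open_adjacent_sym; exact: rt_step.
Qed.

Lemma joined_mono w w' x y :
  (forall e, w e -> w' e) -> joined w x y -> joined w' x y.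
Proof.
move=> ww'; elim=> [{}x {}y [e /ww' w'e ee]|{}x|{}x {}y z _ xy _ yz].
- by apply: rt_step; exists e.
- exact: joined_refl.
- exact: joined_trans xy yz.
Qed.

Lemma cluster_ofE w x y : joined w x y -> cluster_of w x = cluster_of w y.
Proof.
move=> xy; apply/seteqP; split=> z; last exact: joined_trans.
by apply: joined_trans; exact: joined_sym.
Qed.

Lemma meets_infinitely_joined A w x y : joined w x y ->
  meets_infinitely A w x -> meets_infinitely A w y.
Proof. by rewrite /meets_infinitely => /cluster_ofE ->. Qed.

Lemma meets_infinitely_mono A B w w' x : A `<=` B -> (forall e, w e -> w' e) ->
  meets_infinitely A w x -> meets_infinitely B w' x.
Proof.
move=> AB ww'; apply: sub_infinite_set => y [xy /AB By].
by split=> //; exact: joined_mono xy.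
Qed.

(** Vertices stand for their clusters, so that the events of interest are
    countable combinations of connection events. *)
Lemma unique_infinite_clusterP A w : unique_infinite_cluster A w <->
  (exists x, meets_infinitely A w x) /\
  (forall x y, meets_infinitely A w x -> meets_infinitely A w y -> joined w x y).
Proof.
split=> [[K [[[x Kx] Ki] Ku]]|[[x xi] h]].
  split=> [|y z yi zi]; first by exists x; rewrite /meets_infinitely -Kx.
  have Ky : K = cluster_of w y by apply: Ku; split=> //; exists y.
  have Kz : K = cluster_of w z by apply: Ku; split=> //; exists z.
  have : cluster_of w z z by exact: joined_refl.
  by rewrite -Kz Ky.
exists (cluster_of w x); split; first by split=> //; exists x.
by move=> _ [[y ->] yi]; apply: cluster_ofE; exact: h.
Qed.

Lemma infinite_setPseq (A : set V) :
  infinite_set A <-> forall s : seq V, exists x, A x /\ x \notin s.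
Proof.
split=> [iA s|h].
  apply: contrapT => nx; apply: iA; apply: sub_finite_set (finite_seq s) => x Ax.
  by apply: contrapT => /= /negP xs; apply: nx; exists x.
by move=> /finite_seqP[s As]; have [x []] := h s; rewrite As /= => ->.
Qed.

Section Measurability.
Hypothesis cV : countable [set: V].

Lemma measurable_open_adjacent x y :
  measurable [set w : config E | open_adjacent w x y].
Proof.
have [[e ee]|ne] := pselect (exists e : E, \val e = [set x; y]).
  rewrite (_ : mkset _ = [set w : config E | w e]); first exact: measurable_edge.
  apply/seteqP; split=> w /=; last by exists e.
  by move=> [e' we' e'e]; rewrite (_ : e = e')//; apply: val_inj; rewrite e'e.
rewrite (_ : mkset _ = set0)//; apply/seteqP; split=> // w [e _ ee].
by apply: ne; exists e.
Qed.

Lemma measurable_joined x y : measurable [set w : config E | joined w x y].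
Proof.
pose step (Q : config E -> V -> Prop) w u := exists v, open_adjacent w u v /\ Q w v.
pose Q n := iter n step (fun _ u => u = y).
have mQ n u : measurable [set w | Q n w u].
  elim: n u => [|n IH] u /=; first exact: measurable_pred_Prop.
  rewrite -[mkset _]/[set w : config E | exists v, open_adjacent w u v /\ Q n w v].
  apply: measurable_pred_exists => // v; apply: measurable_pred_and => //.
  exact: measurable_open_adjacent.
rewrite (_ : mkset _ = [set w | exists n, Q n w x]).
  by apply: measurable_pred_exists => // n; exact: mQ.
apply/seteqP; split=> w /=; last first.
  move=> [n]; elim: n x => [|n IH] x /=; first by move->; exact: joined_refl.
  by move=> [v [xv /IH]]; apply: joined_trans; exact: rt_step.
move=> /(@clos_rt_rt1n V); rewrite /Q.
elim=> [u|u v z uv _ [n hn]]; first by exists 0%N.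
by exists n.+1, v.
Qed.

Lemma measurable_meets_infinitely A x :
  measurable [set w : config E | meets_infinitely A w x].
Proof.
rewrite (_ : mkset _ = [set w : config E | forall s : seq V,
    exists y, (joined w x y /\ A y) /\ y \notin s]); last first.
  by apply/seteqP; split=> w /infinite_setPseq.
apply: measurable_pred_forall => [|s]; first exact: countable_seq.
apply: measurable_pred_exists => // y.
apply: measurable_pred_and; last exact: measurable_pred_Prop.
apply: measurable_pred_and; last exact: measurable_pred_Prop.
exact: measurable_joined.
Qed.

Lemma measurable_unique_infinite_cluster A :
  measurable [set w : config E | unique_infinite_cluster A w].
Proof.
rewrite (_ : mkset _ = [set w : config E | (exists x, meets_infinitely A w x) /\
  (forall x y, meets_infinitely A w x -> meets_infinitely A w y -> joined w x y)]).
  apply: measurable_pred_and.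
    by apply: measurable_pred_exists => // x; exact: measurable_meets_infinitely.
  apply: measurable_pred_forall => // x; apply: measurable_pred_forall => // y.
  apply: measurable_pred_imply; first exact: measurable_meets_infinitely.
  apply: measurable_pred_imply; first exact: measurable_meets_infinitely.
  exact: measurable_joined.
by apply/seteqP; split=> w /unique_infinite_clusterP.
Qed.

End Measurability.
End Clusters.

(** * Translations of a Cayley graph *)

Section Cayley.
Context (G : groupType) (S : set G).
Local Notation E := (cayley_edges S).
Implicit Types (g x y : G) (A B : set G) (w : config E).

Definition lcoset g A : set G := [set (g * a)%g | a in A].

Lemma lcosetP g A x : lcoset g A x <-> A (g^-1 * x)%g.
Proof.
split=> [[a Aa <-]|]; first by rewrite mulKg.
by exists (g^-1 * x)%g => //; rewrite mulVKg.
Qed.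

Lemma lcosetM g h A : lcoset (g * h)%g A = lcoset g (lcoset h A).
Proof.
apply/seteqP; split=> x.
  by move=> /lcosetP h1; apply/lcosetP; apply/lcosetP; rewrite mulgA -invgM.
by move=> /lcosetP/lcosetP h1; apply/lcosetP; rewrite invgM -mulgA.
Qed.

Lemma lcoset1 A : lcoset 1%g A = A.
Proof.
apply/seteqP; split=> x; first by move=> /lcosetP; rewrite invg1 mul1g.
by move=> Ax; exists x; rewrite // mul1g.
Qed.

Lemma lcoset_pair g x y : lcoset g [set x; y] = [set (g * x)%g; (g * y)%g].
Proof.
apply/seteqP; split=> z; first by move=> [a [->|->] <-]; [left|right].
by case=> ->; [exists x; first left|exists y; first right].
Qed.

Lemma translate_subproof g (e : E) : lcoset g (\val e) \in E.
Proof.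
apply/mem_set; have /set_mem[x [s [Ss s1 ->]]] := valP e.
by exists (g * x)%g, s; split=> //; rewrite lcoset_pair mulgA.
Qed.

Definition translate g (e : E) : E :=
  exist _ (lcoset g (\val e)) (translate_subproof g e).

Lemma translateE g e : \val (translate g e) = lcoset g (\val e). Proof. by []. Qed.

Lemma translate_inj g : injective (translate g).
Proof.
move=> e e' /(congr1 val); rewrite !translateE.
move=> /(congr1 (lcoset g^-1%g)); rewrite -!lcosetM !mulVg !lcoset1.
exact: val_inj.
Qed.

(** An edge [e] is open in [shift_config g w] when [g e] is open in [w]: this is
    the action of [g^-1] on configurations. *)
Definition shift_config g : config E -> config E := relabel (translate g).

Lemma shift_adjacent g w x y :
  open_adjacent (shift_config g w) x y <-> open_adjacent w (g * x)%g (g * y)%g.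
Proof.
split=> [[e we ee]|[e we ee]].
  by exists (translate g e) => //; rewrite translateE ee lcoset_pair.
exists (translate g^-1%g e).
  rewrite /shift_config /relabel (_ : translate _ _ = e)//; apply: val_inj.
  by rewrite !translateE -lcosetM mulgV lcoset1.
by rewrite translateE ee lcoset_pair !mulKg.
Qed.

Lemma shift_joined g w x y :
  joined (shift_config g w) x y <-> joined w (g * x)%g (g * y)%g.
Proof.
split.
  elim=> [{}x {}y /shift_adjacent|{}x|{}x {}y z _ + _]; first exact: rt_step.
    by exact: joined_refl.
  exact: joined_trans.
suff h u v : joined w u v -> joined (shift_config g w) (g^-1 * u)%g (g^-1 * v)%g.
  by move=> /h; rewrite !mulKg.
elim=> [{}u {}v uv|{}u|{}u {}v z _ + _].
- by apply: rt_step; apply/shift_adjacent; rewrite !mulVKg.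
- exact: joined_refl.
- exact: joined_trans.
Qed.

Lemma infinite_lcoset g A : infinite_set (lcoset g A) <-> infinite_set A.
Proof.
suff h k B : infinite_set (lcoset k B) -> infinite_set B.
  split; first exact: h.
  by rewrite -{1}[A]lcoset1 -(mulVg g) lcosetM; exact: h.
by apply: contra_not => fB; exact: finite_image.
Qed.

Lemma shift_meets_infinitely g A w x :
  meets_infinitely A (shift_config g w) x <->
  meets_infinitely (lcoset g A) w (g * x)%g.
Proof.
rewrite /meets_infinitely -(infinite_lcoset g (_ `&` A)).
rewrite (_ : lcoset g _ = cluster_of w (g * x)%g `&` lcoset g A)//.
apply/seteqP; split=> y.
  move=> [z [/shift_joined gxz Az] <-]; split=> //.
  by exists z.
move=> [gxy [a Aa ay]]; exists a => //; split=> //.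
by apply/shift_joined; rewrite ay.
Qed.

(** An edge has two ends and the action on vertices is free, so at most two
    translations carry [e] to [e']. *)
Lemma translate_far (h : nat -> G) : injective h ->
  forall e e', exists N, forall n, (N <= n)%N -> translate (h n) e <> e'.
Proof.
move=> hinj e e'.
have /set_mem[x [s [_ _ ee]]] := valP e.
have /set_mem[x' [s' [_ _ ee']]] := valP e'.
have [N hN] := injective_leaves_seq [:: x' * x^-1; x' * s' * x^-1]%g hinj.
exists N => n /hN + tee'; rewrite !inE => /norP[/eqP hx' /eqP hx's'].
have : \val e' (h n * x)%g.
  by rewrite -tee' translateE; exists x => //; rewrite ee; left.
by rewrite ee' => -[] hx; [apply: hx'|apply: hx's']; rewrite -hx mulgK.
Qed.

Lemma infinite_invariant_zero_one (R : realType) (p : R)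
    (mu : probability (config E) R) (J : set G) (Q : config E -> Prop) :
  bernoulli_percolation p mu -> infinite_set J -> measurable [set w | Q w] ->
  (forall g, J g -> forall w, Q (shift_config g w) <-> Q w) ->
  (0 < mu [set w | Q w])%E -> {ae mu, forall w, Q w}.
Proof.
move=> hmu /infinite_enum[h hinj hJ] mQ invQ Q0; apply/ae_eq1 => //.
apply: (zero_one_law (h := fun n => translate (h n)) hmu _ _ mQ _ Q0).
- by move=> n; exact: translate_inj.
- exact: translate_far.
- move=> n; apply/seteqP; split=> w; have [h1 h2] := invQ _ (hJ n) w.
    exact: h1.
  exact: h2.
Qed.

Lemma ae_shift (R : realType) (p : R) (mu : probability (config E) R) g
    (Q : config E -> Prop) :
  bernoulli_percolation p mu -> measurable [set w | Q w] ->
  {ae mu, forall w, Q w} -> {ae mu, forall w, Q (shift_config g w)}.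
Proof.
move=> hmu mQ /ae_eq1 => /(_ mQ) Q1; apply/ae_eq1.
  exact: (measurable_config_preimage (measurable_relabel _) mQ).
by rewrite -Q1; exact: (bernoulli_relabel (@translate_inj g) hmu mQ).
Qed.

(** The vertices that are joined to [1] form a subgroup, by translation
    invariance, and it contains [S]. *)
Lemma cayley_joined x y : generates S ->
  joined ((fun=> true) : config E) x y.
Proof.
move=> genS; set w : config E := (fun=> true).
have tr g u v : joined w u v -> joined w (g * u)%g (g * v)%g.
  by move=> uv; exact: (iffLR (shift_joined g w u v) uv).
have : [set g | joined w 1%g g] = setT.
  apply: genS.
    split=> [|u v /set_mem hu /set_mem hv]; apply/mem_set.
      exact: joined_refl.
    apply: joined_trans hu (joined_sym _).
    by have := tr (u * v^-1)%g _ _ hv; rewrite mulg1 mulgVK.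
  move=> s Ss /=; have [->|s1] := pselect (s = 1%g); first exact: joined_refl.
  apply/rt_step.
  have es : [set 1%g; s] \in E by apply/mem_set; exists 1%g, s; rewrite mul1g.
  by exists (exist (fun e => e \in E) _ es).
move=> /seteqP[_ /(_ (x^-1 * y)%g I) /(tr x)].
by rewrite mulg1 mulVKg.
Qed.

(** This makes it possible to join two vertices by inserting finitely many
    edges. *)
Lemma joined_finite_path w x y : joined w x y ->
  exists F : seq E, forall w', (forall e, e \in F -> w' e) -> joined w' x y.
Proof.
elim=> [{}x {}y [e we ee]|{}x|{}x {}y z _ [F hF] _ [F' hF']].
- exists [:: e] => w' hw'; apply: rt_step; exists e => //.
  by apply: hw'; rewrite mem_head.
- by exists [::] => w' _; exact: joined_refl.
- exists (F ++ F') => w' h; apply: joined_trans (hF _ _) (hF' _ _) => e eF;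
    by apply: h; rewrite mem_cat eF ?orbT.
Qed.

End Cayley.

(** * Infinite clusters of subgroups and of their cosets at a fixed level *)

Section Subgroup.
Context (G : groupType) (H : set G).
Hypothesis sgH : is_subgroup H.

Lemma subgroup1 : H 1%g. Proof. by apply/set_mem; exact: sgH.1. Qed.

Lemma subgroup_div x y : H x -> H y -> H (x * y^-1)%g.
Proof. by move=> /mem_set Hx /mem_set Hy; apply/set_mem; exact: sgH.2. Qed.

Lemma subgroupV x : H x -> H x^-1%g.
Proof. by rewrite -[x^-1%g]mul1g; exact/subgroup_div/subgroup1. Qed.

Lemma subgroupM x y : H x -> H y -> H (x * y)%g.
Proof. by move=> Hx /subgroupV; rewrite -{2}[y]invgK; exact: subgroup_div. Qed.

Lemma lcoset_id x : H x -> lcoset x H = H.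
Proof.
move=> Hx; apply/seteqP; split=> y.
  by move=> [z Hz <-]; exact: subgroupM.
by move=> Hy; apply/lcosetP; apply: subgroupM => //; exact: subgroupV.
Qed.

End Subgroup.

Section Uniqueness.
Context (G : groupType) (S : set G) (R : realType).
Hypothesis cG : countable [set: G].
Hypothesis genS : generates S.
Local Notation E := (cayley_edges S).
Context (p : R) (mu : probability (config E) R).
Hypothesis hmu : bernoulli_percolation p mu.
Implicit Types (g x y : G) (A B : set G) (w : config E).

Lemma prob_shift g (Q : config E -> Prop) : measurable [set w | Q w] ->
  mu [set w | Q (shift_config g w)] = mu [set w | Q w].
Proof. exact: (bernoulli_relabel (@translate_inj _ _ g) hmu). Qed.

(** The unique [Ga]-infinite cluster contains each point of [Ga] with the same
    probability, which is positive. So it contains infinitely many points of [H]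
    with positive probability, and then almost surely by the zero-one law. *)
Lemma unique_infinite_cluster_subgroup (Ga H : set G) :
  is_subgroup Ga -> is_subgroup H -> H `<=` Ga -> infinite_set H ->
  {ae mu, forall w, unique_infinite_cluster Ga w} ->
  {ae mu, forall w, unique_infinite_cluster H w}.
Proof.
move=> sgGa sgH HGa iH aeGa.
pose Q w := infinite_set [set h | H h /\ meets_infinitely Ga w h].
have mQ : measurable [set w | Q w].
  rewrite (_ : mkset _ = [set w | forall s : seq G,
      exists h, (H h /\ meets_infinitely Ga w h) /\ h \notin s]); last first.
    by apply/seteqP; split=> w /infinite_setPseq.
  apply: measurable_pred_forall => [|s]; first exact: countable_seq.
  apply: measurable_pred_exists => // h.
  apply: measurable_pred_and; last exact: measurable_pred_Prop.
  apply: measurable_pred_and; first exact: measurable_pred_Prop.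
  exact: measurable_meets_infinitely.
have mx x w g : Ga g -> meets_infinitely Ga (shift_config g w) x <->
    meets_infinitely Ga w (g * x)%g.
  move=> Gag; rewrite -[in X in _ <-> X](lcoset_id sgGa Gag).
  exact: shift_meets_infinitely.
have invQ g : H g -> forall w, Q (shift_config g w) <-> Q w.
  move=> Hg w; rewrite /Q -(infinite_lcoset g).
  rewrite (_ : lcoset g _ = [set h | H h /\ meets_infinitely Ga w h])//.
  apply/seteqP; split=> h.
    move=> [k [Hk /(mx _ _ _ (HGa _ Hg)) mk] <-].
    by split=> //; exact: subgroupM.
  move=> [Hh mh]; apply/lcosetP; split.
    by apply: subgroupM => //; exact: subgroupV.
  by apply/(mx _ _ _ (HGa _ Hg)); rewrite mulVKg.
pose B x := [set w : config E | meets_infinitely Ga w x].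
have mB x : measurable (B x) by exact: measurable_meets_infinitely.
have muB x : Ga x -> mu (B x) = mu (B 1%g).
  move=> Gax; rewrite -(prob_shift x (mB 1%g)); congr (mu _).
  by apply/seteqP; split=> w /=; rewrite /B /= (propext (mx _ _ _ Gax)) mulg1.
have B0 : (0 < mu (B 1%g))%E.
  rewrite lt0e measure_ge0 andbT; apply/eqP => B10.
  have : {ae mu, forall w x, Ga x -> ~ meets_infinitely Ga w x}.
    apply: (ae_forall_countable cG) => x; have [Gax|nGax] := pselect (Ga x).
      have /ae_eq0P : mu (B x) = 0%E by rewrite muB.
      by move=> /(_ (mB x)); apply: filterS.
    exact: aeW.
  move=> aenB; have [w [nB]] := ae_exists (filterI aenB aeGa).
  move=> /unique_infinite_clusterP[[x xi] _].
  have [y [xy Gay]] := infinite_setN0 xi.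
  exact/(nB y Gay)/(meets_infinitely_joined xy).
have Q0 : (0 < mu [set w | Q w])%E.
  have [h hinj hH] := infinite_enum iH.
  apply: lt_le_trans B0 _.
  apply: (@le_trans _ _ (mu (lim_sup_set (fun n => B (h n))))).
    by apply: prob_limsup_ge => n //; rewrite muB//; exact/HGa.
  apply: le_measure; rewrite ?inE//.
    by apply: bigcap_measurable => // n _; exact: bigcup_measurable.
  move=> w hw; apply/infinite_setPseq => s.
  have [N hN] := injective_leaves_seq s hinj.
  have [n /= Nn Bn] := hw N I.
  by exists (h n); split=> //; exact: hN.
have aeQ := infinite_invariant_zero_one hmu iH mQ invQ Q0.
apply: filterS2 aeGa aeQ => w /unique_infinite_clusterP[_ uG] Qw.
apply/unique_infinite_clusterP; split.
  have [h [Hh mh]] := infinite_setN0 Qw; exists h.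
  apply: sub_infinite_set Qw => k [Hk mk]; split=> //; exact: uG.
move=> x y xi yi; apply: uG; first exact: meets_infinitely_mono xi.
exact: meets_infinitely_mono yi.
Qed.

Definition same_infinite_clusters A B :=
  {ae mu, forall w, forall x, meets_infinitely A w x <-> meets_infinitely B w x}.

Lemma same_infinite_clusters_lcoset g A B :
  same_infinite_clusters A B ->
  same_infinite_clusters (lcoset g A) (lcoset g B).
Proof.
move=> sAB; have : {ae mu, forall w, forall x,
    meets_infinitely A (shift_config g w) x <->
    meets_infinitely B (shift_config g w) x}.
  apply: (ae_shift g (Q := fun w => forall x,
    meets_infinitely A w x <-> meets_infinitely B w x) hmu) => //.
  apply: measurable_pred_forall => // x; apply: measurable_pred_and;
    by apply: measurable_pred_imply; exact: measurable_meets_infinitely.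
apply: filterS => w h x; have := h (g^-1 * x)%g.
by rewrite !(propext (shift_meets_infinitely _ _ _ _)) mulVKg.
Qed.

Lemma unique_infinite_cluster_lcoset g A :
  {ae mu, forall w, unique_infinite_cluster A w} ->
  {ae mu, forall w, unique_infinite_cluster (lcoset g A) w}.
Proof.
move=> /(ae_shift g hmu (measurable_unique_infinite_cluster cG A)).
apply: filterS => w /unique_infinite_clusterP[[x xi] u].
apply/unique_infinite_clusterP; split.
  by exists (g * x)%g; apply/shift_meets_infinitely.
move=> y z yi zi; have := u (g^-1 * y)%g (g^-1 * z)%g.
rewrite !(propext (shift_meets_infinitely _ _ _ _)).
rewrite (propext (shift_joined _ _ _ _)).
by rewrite !mulVKg; apply.
Qed.

(** The cosets [g H] that share the infinite cluster of [H] are those of a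
    subgroup [L]. If [L] is proper, wq-normality gives [g] outside [L] such that
    infinitely many translations preserve the event that [H] and [g H] share
    their infinite cluster. This event has positive probability by insertion
    tolerance, hence probability 1, so that [g] belongs to [L]. *)
Lemma same_infinite_clusters_wq_normal (Ga H : set G) :
  0 < p -> is_subgroup Ga -> is_subgroup H -> H `<=` Ga ->
  (forall I, is_subgroup I -> H `<=` I -> I `<=` Ga -> I <> Ga ->
     exists g, [/\ Ga g, ~ I g & infinite_set (conjugate g I `&` I)]) ->
  {ae mu, forall w, unique_infinite_cluster H w} ->
  forall g, Ga g -> same_infinite_clusters H (lcoset g H).
Proof.
move=> p0 sgGa sgH HGa wq aeH.
pose L := [set g | Ga g /\ same_infinite_clusters H (lcoset g H)].
have LGa : L `<=` Ga by move=> g [].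
have sgL : is_subgroup L.
  split=> [|u v /set_mem[Gau su] /set_mem[Gav sv]]; apply/mem_set; split.
  - exact: subgroup1.
  - by rewrite lcoset1; exact: aeW.
  - exact: subgroup_div.
  - have := same_infinite_clusters_lcoset (u * v^-1)%g sv.
    rewrite -lcosetM mulgVK => suv.
    move: su suv; rewrite /same_infinite_clusters; apply: filterS2 => w h1 h2 x.
    by rewrite (propext (h2 x)) (propext (h1 x)).
have HL : H `<=` L.
  by move=> h Hh; split; [exact: HGa|rewrite lcoset_id//; exact: aeW].
suff -> : Ga = L by move=> g [].
apply: contrapT => LneGa.
have [||||g [Gag nLg iJ]] := wq L => //; first by move/esym.
(* Quantifying over all cosets l H with l in L makes the event exactly invariant
   under J, not just up to a null set. *)
pose D w := exists x, (forall l, L l -> meets_infinitely (lcoset l H) w x) /\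
  (forall l, L l -> meets_infinitely (lcoset (g * l)%g H) w x).
have mD : measurable [set w | D w].
  apply: measurable_pred_exists => // x.
  by apply: measurable_pred_and; apply: measurable_pred_forall => // l;
    apply: measurable_pred_imply; try exact: measurable_pred_Prop;
    exact: measurable_meets_infinitely.
have invD j : (conjugate g L `&` L) j -> forall w, D (shift_config j w) <-> D w.
  move=> [[m Lm jE] Lj] w; have jg l : (j * (g * l) = g * (m * l))%g.
    by rewrite -jE !mulgA mulgVK.
  split=> -[x [h1 h2]].
    exists (j * x)%g; split=> l Ll.
      have /h1 := subgroupM sgL (subgroupV sgL Lj) Ll.
      by move=> /shift_meets_infinitely; rewrite -lcosetM mulVKg.
    have /h2 := subgroupM sgL (subgroupV sgL Lm) Ll.
    by move=> /shift_meets_infinitely; rewrite -lcosetM jg mulVKg.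
  exists (j^-1 * x)%g; split=> l Ll; apply/shift_meets_infinitely;
    rewrite mulVKg -lcosetM.
    exact: h1 _ (subgroupM sgL Lj Ll).
  by rewrite jg; exact: h2 _ (subgroupM sgL Lm Ll).
have aegH := unique_infinite_cluster_lcoset g aeH.
have aeL : {ae mu, forall w, forall l, L l -> forall x,
    (meets_infinitely H w x <-> meets_infinitely (lcoset l H) w x) /\
    (meets_infinitely (lcoset g H) w x <->
     meets_infinitely (lcoset (g * l)%g H) w x)}.
  apply: (ae_forall_countable cG) => l.
  have [Ll|nLl] := pselect (L l); last exact: aeW.
  have := same_infinite_clusters_lcoset g Ll.2; rewrite -lcosetM.
  move: Ll.2; rewrite /same_infinite_clusters; apply: filterS2 => w h1 h2 _ x.
  by split; [exact: h1|exact: h2].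
have D0 : (0 < mu [set w | D w])%E.
  rewrite lt0e measure_ge0 andbT; apply/eqP => /(ae_eq0P _ mD) aenD.
  pose N w := ~ exists x,
    meets_infinitely H w x /\ meets_infinitely (lcoset g H) w x.
  have mN : measurable [set w | N w].
    apply: measurable_pred_not; apply: measurable_pred_exists => // x.
    by apply: measurable_pred_and; exact: measurable_meets_infinitely.
  have aeN : {ae mu, forall w, N w}.
    apply: filterS2 aenD aeL => w nDw Lw [x [x1 x2]]; apply: nDw; exists x.
    by split=> l Ll; have [h1 h2] := Lw l Ll x; [exact/h1|exact/h2].
  have : {ae mu, forall w, forall xy : G * G,
     exists2 F : seq E, N (insert_edges F w) &
       forall w', (forall e, e \in F -> w' e) -> joined w' xy.1 xy.2}.
    apply: ae_forall_countable => [|[x y] /=].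
      by rewrite -setXTT; exact: countableX.
    have [F hF] := joined_finite_path (cayley_joined x y genS).
    apply: filterS (insertion_tolerance F hmu p0 mN aeN) => w Nw.
    by exists F.
  move=> aeF; have [w [h []]] := ae_exists (filterI aeF (filterI aeH aegH)).
  move=> /unique_infinite_clusterP[[x xi] _] /unique_infinite_clusterP[[y yi] _].
  have [F nF hF] := h (x, y).
  apply: nF; exists x; split.
    by apply: meets_infinitely_mono xi => // e we; rewrite /insert_edges we orbT.
  apply: (@meets_infinitely_joined _ _ _ _ y).
    by apply/joined_sym/hF => e eF; rewrite /insert_edges eF.
  by apply: meets_infinitely_mono yi => // e we; rewrite /insert_edges we orbT.
have aeD := infinite_invariant_zero_one hmu iJ mD invD D0.
apply: nLg; split=> //.
rewrite /same_infinite_clusters; move: aeD aeH aegH.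
apply: filterS3 => w [x [h1 h2]].
have := h1 _ (subgroup1 sgL); rewrite lcoset1 => x1.
have := h2 _ (subgroup1 sgL); rewrite mulg1 => x2.
move=> /unique_infinite_clusterP[_ u1] /unique_infinite_clusterP[_ u2] y.
split=> yi; [apply: meets_infinitely_joined x2; exact: u1|
             apply: meets_infinitely_joined x1; exact: u2].
Qed.

End Uniqueness.

(** * Sprinkling around an equivariant cluster *)

(** Indices that are not [ok] carry no element, so that finite and empty sets
    [A] are covered as well. *)
Lemma countable_enum (G : groupType) (A : set G) : countable [set: G] ->
  exists (x_ : nat -> G) (ok : nat -> Prop),
    [/\ forall i, ok i -> A (x_ i), forall x, A x -> exists2 i, ok i & x_ i = x &
        forall i j, ok i -> ok j -> x_ i = x_ j -> i = j].
Proof.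
move=> /countable_injP[f finj].
have {}finj x y : f x = f y -> x = y by apply: finj; rewrite inE.
pose x_ i := xget 1%g [set x | A x /\ f x = i].
pose ok i := exists x, A x /\ f x = i.
have xP i : ok i -> A (x_ i) /\ f (x_ i) = i.
  by move=> [x hx]; rewrite /x_; case: xgetP => [y _ //|/(_ x)].
exists x_, ok; split.
- by move=> i /xP[].
- move=> x Ax; have okx : ok (f x) by exists x.
  by exists (f x) => //; apply: finj; exact: (xP _ okx).2.
- by move=> i j /xP[_ hi] /xP[_ hj] hij; rewrite -hi -hj hij.
Qed.

Section Sprinkling.
Context (G : groupType) (S : set G) (R : realType).
Hypothesis cG : countable [set: G].
Hypothesis genS : generates S.
Local Notation E := (cayley_edges S).
Implicit Types (g x y : G) (w : config E).
Implicit Types (t : config E * config E).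

Definition all_edges_open : config E := fun=> true.

Lemma adjacent_translate g x y :
  open_adjacent all_edges_open (g * x)%g (g * y)%g <->
  open_adjacent all_edges_open x y.
Proof. exact: iff_sym (shift_adjacent g all_edges_open x y). Qed.

Lemma ae_fst (mu nu : probability (config E) R) (Q : config E -> Prop) :
  measurable [set w | Q w] -> {ae mu, forall w, Q w} ->
  {ae (mu \x nu)%E, forall t, Q t.1}.
Proof.
move=> mQ /(ae_eq1 _ mQ) Q1; apply/(ae_eq1 (mu \x nu)%E).
  exact: measurable_pred_fst.
rewrite (_ : mkset _ = [set w | Q w] `*` setT).
  transitivity (mu [set w | Q w] * nu setT)%E; first exact: product_measure1E.
  by rewrite Q1 probability_setT mule1.
by apply/seteqP; split=> t //= [].
Qed.

Definition shift_pair g t := (shift_config g t.1, shift_config g t.2).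

Lemma union_shift_pair g t :
  union_config (shift_pair g t) = shift_config g (union_config t).
Proof. by []. Qed.

Lemma measurable_shift_pair g (A : set (config E * config E)) :
  measurable A -> measurable (shift_pair g @^-1` A).
Proof.
move=> mA; rewrite -[X in measurable X]setTI.
have mf : measurable_fun setT (shift_pair g).
  apply/measurable_fun_pairP; split.
    apply: measurable_to_config => e.
    exact: (measurable_pred_fst (measurable_edge (translate g e))).
  apply: measurable_to_config => e.
  exact: (measurable_pred_snd (measurable_edge (translate g e))).
exact: mf.
Qed.

Lemma prob_shift_pair p q (mu nu : probability (config E) R) g A :
  bernoulli_percolation p mu -> bernoulli_percolation q nu -> measurable A ->
  (mu \x nu)%E (shift_pair g @^-1` A) = (mu \x nu)%E A.
Proof.
move=> hmu hnu mA.
have mf : measurable_fun setT (shift_pair g).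
  by move=> _ B mB; rewrite setTI; exact: measurable_shift_pair.
pose F : {mfun (config E * config E)%type >-> (config E * config E)%type} :=
  HB.pack (shift_pair g) (isMeasurableFun.Build _ _ _ _ (shift_pair g) mf).
pose m' := distribution (mu \x nu)%E F.
have h B C : measurable B -> measurable C -> m' (B `*` C) = (mu B * nu C)%E.
  move=> mB mC.
  rewrite -(bernoulli_relabel (@translate_inj _ _ g) hmu mB).
  rewrite -(bernoulli_relabel (@translate_inj _ _ g) hnu mC).
  transitivity ((mu \x nu)%E
      ((shift_config g @^-1` B) `*` (shift_config g @^-1` C))).
    by congr ((mu \x nu)%E _).
  by apply: product_measure1E;
    exact: (measurable_config_preimage (measurable_relabel _)).
have := product_measure_unique (m1 := mu) (m2 := nu) (m' := m') h mA.
by move=> ->.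
Qed.

Lemma measurable_union (Q : config E -> Prop) : measurable [set w | Q w] ->
  measurable [set t | Q (union_config t)].
Proof.
move=> mQ.
exact: (measurable_config_preimage (@measurable_union_config _ _) mQ).
Qed.

Lemma measurable_union_joined x y :
  measurable [set t : config E * config E | joined (union_config t) x y].
Proof. exact: (measurable_union (measurable_joined cG x y)). Qed.

Lemma measurable_union_meets_infinitely (A : set G) x :
  measurable [set t : config E * config E | meets_infinitely A (union_config t) x].
Proof. exact: (measurable_union (measurable_meets_infinitely cG A x)). Qed.

(** [K] is a random set of vertices, the core. In the application it is the
    cluster shared by all the cosets of [H]; distances to it are measured in the
    Cayley graph. *)
Context (K : config E -> G -> Prop).
Hypothesis mK : forall x, measurable [set w | K w x].

Fixpoint near_core (r : nat) w x : Prop :=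
  if r is r'.+1 then
    near_core r' w x \/
    exists y, open_adjacent all_edges_open x y /\ near_core r' w y
  else K w x.

Lemma measurable_near_core r x : measurable [set w | near_core r w x].
Proof.
elim: r x => [|r IH] x //=; apply: measurable_pred_or => //.
apply: measurable_pred_exists => // y; apply: measurable_pred_and => //.
exact: measurable_pred_Prop.
Qed.

Lemma near_core_joined w x k : K w k -> exists r, near_core r w x.
Proof.
move=> Kk; have := cayley_joined x k genS => /(@clos_rt_rt1n G) xk.
elim: xk Kk => [{}x|{}x y z xy _ IH] Kz; first by exists 0%N.
by have [r hr] := IH Kz; exists r.+1; right; exists y.
Qed.

Definition avoids r w w' x := forall y, joined w' x y -> ~ near_core r w y.
Definition frontier r w w' x := [set y | joined w' x y /\ near_core r.+1 w y].

Lemma measurable_avoids r x :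
  measurable [set t | avoids r t.1 (union_config t) x].
Proof.
apply: measurable_pred_forall => // y; apply: measurable_pred_imply.
  exact: measurable_union_joined.
exact: (measurable_pred_fst (measurable_pred_not (measurable_near_core r y))).
Qed.

Lemma measurable_in_frontier r x y :
  measurable [set t | frontier r t.1 (union_config t) x y].
Proof.
apply: measurable_pred_and; first exact: measurable_union_joined.
exact: (measurable_pred_fst (measurable_near_core r.+1 y)).
Qed.

Lemma measurable_infinite_frontier r x :
  measurable [set t | infinite_set (frontier r t.1 (union_config t) x)].
Proof.
rewrite (_ : mkset _ = [set t | forall s : seq G,
    exists y, frontier r t.1 (union_config t) x y /\ y \notin s]); last first.
  by apply/seteqP; split=> t /infinite_setPseq.
apply: measurable_pred_forall => [|s]; first exact: countable_seq.
apply: measurable_pred_exists => // y.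
apply: measurable_pred_and; first exact: measurable_in_frontier.
exact: measurable_pred_Prop.
Qed.

(** Fix [w] and the new edges [s1] off the [r]-neighbourhood [N] of the core. If
    the cluster of [x] avoids [N], then it can be read off from this information
    alone. Each of the infinitely many frontier vertices has an edge into [N],
    and all these edges have to be closed in the independent sample [s2]. *)
Lemma infinite_frontier_null q (mu nu : probability (config E) R) r x :
  bernoulli_percolation q nu -> 0 < q ->
  {ae (mu \x nu)%E, forall t, ~ (avoids r t.1 (union_config t) x /\
     infinite_set (frontier r t.1 (union_config t) x))}.
Proof.
move=> hnu q0.
have mB : measurable [set t | avoids r t.1 (union_config t) x /\
     infinite_set (frontier r t.1 (union_config t) x)].
  apply: measurable_pred_and; first exact: measurable_avoids.
  exact: measurable_infinite_frontier.
apply/(ae_eq0P (mu \x nu)%E mB); apply: (product_null mu mB) => w /=.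
have := measurable_xsection w mB; rewrite xsectionE.
set B := _ @^-1` _ => {}mB; rewrite -[LHS]/(nu B).
pose N := near_core r w.
pose F (e : E) := `[< forall v, \val e v -> ~ N v >].
pose u (s : config E) : config E := fun e => F e && (w e || s e).
rewrite -(bernoulli_splice F hnu mB).
have mB' := measurable_config_preimage (measurable_splice F) mB.
apply: (product_null nu mB') => s1 /=.
have := measurable_xsection s1 mB'; rewrite xsectionE.
set B2 := _ @^-1` _ => {}mB'; rewrite -[LHS]/(nu B2).
(* D depends on w and s1 only: it is fixed before s2 is drawn. *)
pose D := [set e : E | exists
  y z, [/\ joined (u s1) x y, N z & \val e = [set y; z]]].
pose s s2 := splice F (s1, s2).
have cl s2 y : B (s s2) ->
    (joined (union_config (w, s s2)) x y <-> joined (u s1) x y).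
  move=> [av _]; split; last first.
    apply: joined_mono => e; rewrite /u /union_config /s /splice /=.
    by case: (F e).
  move=> xy; have := joined_refl (union_config (w, s s2)) x; move: xy.
  suff gen a b : joined (union_config (w, s s2)) a b ->
      joined (union_config (w, s s2)) x a -> joined (u s1) a b by exact: gen.
  elim=> [{}a {}b ab xa|{}a _|{}a {}b c ab IHab bc IHbc xa].
  - have xb := joined_trans xa (rt_step _ _ _ _ ab).
    apply: rt_step; have [e we ee] := ab; exists e => //.
    have Fe : F e by apply/asboolP => v; rewrite ee => -[->|->]; exact: av.
    by move: we; rewrite /u /union_config /s /splice /= Fe.
  - exact: joined_refl.
  - apply: joined_trans (IHab xa) (IHbc _); exact: joined_trans xa ab.
have closedD s2 : B (s s2) -> forall e, D e -> ~ s2 e.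
  move=> Bs e [y [z [xy Nz ee]]] s2e; have [av _] := Bs.
  apply: (av z) => //; apply: joined_trans (_ : joined _ y z).
    by apply/(cl s2).
  apply: rt_step; exists e => //; rewrite /union_config /s /splice /=.
  case: ifPn => [/asboolP/(_ z)|_]; last by rewrite s2e orbT.
  by rewrite ee => /(_ (or_intror erefl)).
have [iD|fD] := pselect (infinite_set D).
  have := infinite_not_all_closed hnu q0 iD.
  move=> h; apply/(ae_eq0P nu mB'); apply: filterS h => s2 h Bs; apply: h.
  exact: closedD.
rewrite (_ : B2 = set0) ?measure0//; apply/seteqP; split=> // s2 Bs.
have [av ifr] := Bs; apply: ifr.
have /contrapT {}fD := fD.
apply: (@sub_finite_set _ _ (\bigcup_(e in D) (\val e))).
  move=> y [xy]; have nNy := av y xy.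
  move=> [//|[z [[e _ ee] Nz]]]; exists e; last by rewrite ee; left.
  by exists y, z; split=> //; apply/(cl s2).
apply: bigcup_finite => // e [y [z [_ _ ->]]].
by rewrite finite_setU; split; exact: finite_set1.
Qed.

Context (Ga : set G).
Hypothesis sgGa : is_subgroup Ga.
Hypothesis equivK : forall g, Ga g ->
  forall w x, K (shift_config g w) x <-> K w (g * x)%g.

Lemma near_core_shift r g w x : Ga g ->
  near_core r (shift_config g w) x <-> near_core r w (g * x)%g.
Proof.
move=> Gag; elim: r x => [|r IH] x /=; first exact: equivK.
split=> -[/IH h|[y [xy ny]]]; [by left|right|by left|right].
  by exists (g * y)%g; split; [exact/adjacent_translate|exact/IH].
exists (g^-1 * y)%g; split; last by apply/IH; rewrite mulVKg.
by apply/(adjacent_translate g); rewrite mulVKg.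
Qed.

Definition finite_frontier m r t y := [/\ near_core r.+1 t.1 y,
  meets_infinitely Ga (union_config t) y &
  exists l : seq G, (size l <= m)%N /\
    forall z, frontier r t.1 (union_config t) y z -> z \in l].

Lemma measurable_finite_frontier m r y :
  measurable [set t | finite_frontier m r t y].
Proof.
rewrite (_ : mkset _ = [set t | near_core r.+1 t.1 y /\
  (meets_infinitely Ga (union_config t) y /\
  exists l : seq G, (size l <= m)%N /\
    forall z, frontier r t.1 (union_config t) y z -> z \in l)]); last first.
  by apply/seteqP; split=> t [] // a [].
apply: measurable_pred_and.
  exact: (measurable_pred_fst (measurable_near_core r.+1 y)).
apply: measurable_pred_and; first exact: measurable_union_meets_infinitely.
apply: measurable_pred_exists => [|l]; first exact: countable_seq.
apply: measurable_pred_and; first exact: measurable_pred_Prop.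
apply: measurable_pred_forall => // z; apply: measurable_pred_imply.
  exact: measurable_in_frontier.
exact: measurable_pred_Prop.
Qed.

Lemma finite_frontier_shift m r g t y : Ga g ->
  finite_frontier m r (shift_pair g t) y <-> finite_frontier m r t (g * y)%g.
Proof.
move=> Gag; rewrite /finite_frontier /frontier union_shift_pair.
rewrite -[(shift_pair g t).1]/(shift_config g t.1).
rewrite (propext (near_core_shift r.+1 t.1 y Gag)).
rewrite (propext (shift_meets_infinitely _ _ _ _)) lcoset_id//.
split=> -[h1 h2 [l [lm hl]]]; split=> //.
  exists [seq (g * z)%g | z <- l]; rewrite size_map; split=> // z [yz nz].
  apply/mapP; exists (g^-1 * z)%g; last by rewrite mulVKg.
  apply: hl; split; first by apply/shift_joined; rewrite mulVKg.
  by apply/(near_core_shift r.+1 t.1 _ Gag); rewrite mulVKg.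
exists [seq (g^-1 * z)%g | z <- l]; rewrite size_map; split=> // z.
move=> [/shift_joined yz /(near_core_shift r.+1 t.1 _ Gag) nz].
by apply/mapP; exists (g * z)%g; [exact: hl|rewrite mulKg].
Qed.

(** Mass transport: when [y] is on the frontier of its cluster and there are at
    most [m] frontier vertices, every point of [Ga] in this cluster sends unit
    mass to [y]. The event [Z i] says that [x_ i] does so, and [W i] is its
    translate, in which [1] sends mass to [(x_ i)^-1 * y]. Since [1] sends mass
    at most [m], the probabilities of the [W i], and so those of the [Z i], have
    sum at most [m]. Hence [y] almost surely receives a finite mass, while a
    [Ga]-infinite cluster would send an infinite one. *)
Lemma finite_frontier_null p q (mu nu : probability (config E) R) m r y :
  bernoulli_percolation p mu -> bernoulli_percolation q nu ->
  {ae (mu \x nu)%E, forall t, ~ finite_frontier m r t y}.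
Proof.
move=> hmu hnu; have [x_ [ok [okG okx okinj]]] := countable_enum Ga cG.
pose W i := [set t : config E * config E | ok i /\
  (joined (union_config t) ((x_ i)^-1 * y)%g 1%g /\
   finite_frontier m r t ((x_ i)^-1 * y)%g)].
pose Z i := [set t : config E * config E | ok i /\
  (joined (union_config t) y (x_ i) /\ finite_frontier m r t y)].
have mW i : measurable (W i).
  apply: measurable_pred_and; first exact: measurable_pred_Prop.
  apply: measurable_pred_and; first exact: measurable_union_joined.
  exact: measurable_finite_frontier.
have mZ i : measurable (Z i).
  apply: measurable_pred_and; first exact: measurable_pred_Prop.
  apply: measurable_pred_and; first exact: measurable_union_joined.
  exact: measurable_finite_frontier.
have ZW i : (mu \x nu)%E (Z i) = (mu \x nu)%E (W i).
  have [oki|noki] := pselect (ok i); last first.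
    by congr ((mu \x nu)%E _); apply/seteqP; split=> t [].
  rewrite -(prob_shift_pair (x_ i) hmu hnu (mW i)); congr ((mu \x nu)%E _).
  apply/seteqP; split=> t; rewrite /Z /W /= union_shift_pair
    (propext (finite_frontier_shift _ _ _ _ (okG i oki)))
    (propext (shift_joined _ _ _ _)) mulVKg mulg1//.
have Wm n t : (\sum_(i < n) (t \in W i) <= m)%N.
  have [[i0 Wi0]|nW] := pselect (exists i : 'I_n, W i t); last first.
    rewrite big1// => i _; rewrite memNset// => Wi; apply: nW; by exists i.
  have [_ [j0 [_ _ [l [lm hl]]]]] := Wi0.
  apply: leq_trans lm.
  rewrite (eq_bigr (fun i : 'I_n => if t \in W i then 1 else 0)%N); last first.
    by move=> i _; case: (_ \in _).
  rewrite -big_mkcond sum1_card cardE.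
  rewrite -(size_map (fun i : 'I_n => (x_ i)^-1 * y)%g).
  apply: uniq_leq_size.
    rewrite map_inj_in_uniq ?enum_uniq// => i j.
    rewrite !mem_enum !inE => -[oki _] [okj _] /mulIg/invg_inj /okinj h.
    exact/val_inj/h.
  move=> z /mapP[i]; rewrite mem_enum inE => -[oki [ji [ni _ _]]] ->.
  by apply: hl; split=> //; apply: joined_trans j0 (joined_sym ji).
have sumZ n : (\sum_(i < n) (mu \x nu) (Z i) <= m%:R%:E)%E.
  by under eq_bigr do rewrite ZW; exact: sum_prob_le.
apply: filterS (ae_finitely_often mZ sumZ) => t nZ ft; apply: nZ => N _.
have [_ /infinite_setPseq iC _] := ft.
have [x [[yx Gax] xs]] := iC [seq x_ i | i <- iota 0 N].
have [i oki xi] := okx x Gax.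
exists i; last by rewrite /Z /= xi.
rewrite /= leqNgt; apply/negP => iN; move/negP: xs; apply.
by rewrite -xi; apply: map_f; rewrite mem_iota.
Qed.

(** At its least distance from the core, a [Ga]-infinite cluster that misses the
    core would realize one of the two null events above. *)
Lemma sprinkled_unique_infinite_cluster p q (mu nu : probability (config E) R) :
  bernoulli_percolation p mu -> bernoulli_percolation q nu -> 0 < q ->
  {ae mu, forall w, [/\ exists x, K w x,
    forall x y, K w x -> K w y -> joined w x y &
    forall x, K w x -> meets_infinitely Ga w x]} ->
  {ae (mu \x nu)%E, forall t, unique_infinite_cluster Ga (union_config t)}.
Proof.
move=> hmu hnu q0 aeK.
have {}aeK : {ae (mu \x nu)%E, forall t, [/\ exists x, K t.1 x,
    forall x y, K t.1 x -> K t.1 y -> joined t.1 x y &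
    forall x, K t.1 x -> meets_infinitely Ga t.1 x]}.
  apply: (ae_fst nu (Q := fun w => [/\ exists x, K w x,
    forall x y, K w x -> K w y -> joined w x y &
    forall x, K w x -> meets_infinitely Ga w x])) => //.
  rewrite (_ : mkset _ = [set w | (exists x, K w x) /\
    ((forall x y, K w x -> K w y -> joined w x y) /\
    forall x, K w x -> meets_infinitely Ga w x)]).
    apply: measurable_pred_and; first exact: measurable_pred_exists.
    apply: measurable_pred_and.
      apply: measurable_pred_forall => // x; apply: measurable_pred_forall => // y.
      apply: measurable_pred_imply => //; apply: measurable_pred_imply => //.
      exact: measurable_joined.
    apply: measurable_pred_forall => // x.
    apply: measurable_pred_imply => //; exact: measurable_meets_infinitely.
  by apply/seteqP; split=> w [] // a [].
have aeA : {ae (mu \x nu)%E, forall t r x, ~ (avoids r t.1 (union_config t) x /\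
     infinite_set (frontier r t.1 (union_config t) x))}.
  apply: ae_forall_countable => // r; apply: ae_forall_countable => // x.
  exact: infinite_frontier_null hnu q0.
have aeB : {ae (mu \x nu)%E, forall t m r y, ~ finite_frontier m r t y}.
  apply: ae_forall_countable => // m; apply: ae_forall_countable => // r.
  apply: ae_forall_countable => // y; exact: finite_frontier_null hmu hnu.
move: aeK aeA aeB; apply: filterS3 => t [[k Kk] Ku Ki] nA nB.
have tU e : t.1 e -> union_config t e by rewrite /union_config => ->.
have reach x : meets_infinitely Ga (union_config t) x ->
    exists2 z, joined (union_config t) x z & K t.1 z.
  move=> ix; apply: contrapT => nz.
  suff no r y : joined (union_config t) x y -> ~ near_core r t.1 y.
    have [r hr] := near_core_joined x Kk.
    exact: no (joined_refl _ _) hr.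
  elim: r y => [|r IH] y xy ny; first by apply: nz; exists y.
  have fin : finite_set (frontier r t.1 (union_config t) x).
    by apply: contrapT => inf; apply: (nA r x); split.
  have /finite_seqP[l hl] := fin.
  apply: (nB (size l) r y); split=> //; first exact: meets_infinitely_joined xy ix.
  exists l; split=> // z [yz nz']; have : frontier r t.1 (union_config t) x z.
    by split=> //; exact: joined_trans xy yz.
  by rewrite hl.
apply/unique_infinite_clusterP; split.
  by exists k; apply: meets_infinitely_mono (Ki k Kk).
move=> x y /reach[u xu Ku'] /reach[v yv Kv].
apply: joined_trans xu (joined_trans _ (joined_sym yv)).
by apply: joined_mono (Ku u v Ku' Kv).
Qed.

End Sprinkling.

(** * Critical values *)

Section CriticalValues.
Context (G : groupType) (S : set G) (R : realType).
Hypothesis finS : finite_set S.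
Hypothesis genS : generates S.
Local Notation E := (cayley_edges S).
Implicit Types (g x y : G) (w : config E) (p : R).

Let cG : countable [set: G] := countable_generated finS genS.

Lemma unique_infinite_cluster_neq0 p (mu : probability (config E) R) (A : set G) :
  bernoulli_percolation p mu -> {ae mu, forall w, unique_infinite_cluster A w} ->
  p != 0.
Proof.
move=> hmu aeA; apply/eqP => p0.
have cE : countable [set: E].
  by rewrite (eq_countable (card_setT _)); exact: countable_cayley_edges.
have : {ae mu, forall w (e : E), ~ w e}.
  apply: ae_forall_countable => // e; apply/ae_eq0P; first exact: measurable_edge.
  by rewrite -[RHS]/((0:R)%:E) -p0; exact: hmu.1.
move=> aeE; have [w [we]] := ae_exists (filterI aeE aeA).
move=> /unique_infinite_clusterP[[x xi] _]; apply: xi.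
apply: (@sub_finite_set _ _ [set x]); last exact: finite_set1.
move=> y [xy _]; have : joined w x y by [].
by elim=> [a b [e /we]//|//|a b c _ -> _ ->].
Qed.

Lemma p_u_ge0_le1 (A : set G) : 0 <= (p_u E A : R) <= 1.
Proof.
rewrite /p_u; set U := [set p : R | _].
have [[p Up]|nU] := pselect (U !=set0); last first.
  rewrite (_ : U = set0) ?inf0 ?lexx ?ler01//; apply/seteqP; split=> // p Up.
  by apply: nU; exists p.
apply/andP; split; first by apply: lb_le_inf; [exists p|move=> q [/andP[]]].
apply: le_trans (_ : p <= 1); last by have [/andP[]] := Up.
by apply: ge_inf => //; exists 0 => q [/andP[]].
Qed.

Lemma p_u_le (A : set G) p : 0 <= p <= 1 -> as_unique_infinite_cluster E p A ->
  p_u E A <= p.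
Proof. by move=> p01 hp; apply: ge_inf; [exists 0 => q [/andP[]]|split]. Qed.

Context (Ga H : set G).
Hypotheses (sgGa : is_subgroup Ga) (sgH : is_subgroup H).
Hypotheses (HGa : H `<=` Ga) (iH : infinite_set H).
Hypothesis wq : forall I, is_subgroup I -> H `<=` I -> I `<=` Ga -> I <> Ga ->
  exists g, [/\ Ga g, ~ I g & infinite_set (conjugate g I `&` I)].

Lemma as_unique_infinite_cluster_sprinkle p s :
  0 <= p <= 1 -> 0 < s <= 1 -> as_unique_infinite_cluster E p H ->
  as_unique_infinite_cluster E (p + (1 - p) * s) Ga.
Proof.
move=> p01 /andP[s0 s1] hp la hla.
have cE := countable_cayley_edges finS genS.
have [mu hmu] := bernoulli_percolation_exists p01 cE.
have s01 : 0 <= s <= 1 by rewrite ltW.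
have [nu hnu] := bernoulli_percolation_exists s01 cE.
have aeH := hp _ hmu.
have p0 : 0 < p.
  by rewrite lt0r (unique_infinite_cluster_neq0 hmu aeH); case/andP: p01.
have same := same_infinite_clusters_wq_normal cG genS hmu p0 sgGa sgH HGa wq aeH.
(* The intersection over all cosets is almost surely the infinite cluster of H,
   and it is equivariant under Ga without exceptional null sets. *)
pose K w x := forall g, Ga g -> meets_infinitely (lcoset g H) w x.
have mK x : measurable [set w | K w x].
  apply: measurable_pred_forall => // g.
  apply: measurable_pred_imply; first exact: measurable_pred_Prop.
  exact: measurable_meets_infinitely.
have equivK g : Ga g -> forall w x, K (shift_config g w) x <-> K w (g * x)%g.
  move=> Gag w x; split=> hK h Gah.
    have /hK := subgroupM sgGa (subgroupV sgGa Gag) Gah.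
    by move=> /shift_meets_infinitely; rewrite -lcosetM mulVKg.
  apply/shift_meets_infinitely; rewrite -lcosetM; apply: hK.
  exact: subgroupM.
have KH w x : K w x -> meets_infinitely H w x.
  by move=> /(_ _ (subgroup1 sgGa)); rewrite lcoset1.
have aeK : {ae mu, forall w, [/\ exists x, K w x,
    forall x y, K w x -> K w y -> joined w x y &
    forall x, K w x -> meets_infinitely Ga w x]}.
  have aesame : {ae mu, forall w g, Ga g -> forall x,
      meets_infinitely H w x <-> meets_infinitely (lcoset g H) w x}.
    apply: (ae_forall_countable cG) => g.
    have [Gag|nGag] := pselect (Ga g); last exact: aeW.
    by have := same g Gag; rewrite /same_infinite_clusters; apply: filterS.
  move: aesame aeH; apply: filterS2 => w sw /unique_infinite_clusterP[[x xi] u].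
  split.
  - by exists x => g Gag; apply/(sw g Gag).
  - by move=> y z /KH yi /KH zi; exact: u.
  - by move=> y /KH; exact: meets_infinitely_mono.
have := sprinkled_unique_infinite_cluster cG genS mK sgGa equivK hmu hnu s0 aeK.
have mU := measurable_unique_infinite_cluster (E := E) cG Ga.
move=> /(ae_eq1 (mu \x nu)%E (measurable_union mU)) h1.
apply/(ae_eq1 la mU); rewrite -h1; apply: esym.
exact: bernoulli_sprinkle hmu hnu hla mU.
Qed.

(** Were some [p] good for [H] below [p_u E Ga], sprinkling from [p] up to the
    midpoint between the two would give a good level for [Ga] that is too low. *)
Lemma as_unique_at_p_u_subgroup :
  as_unique_infinite_cluster E (p_u E Ga : R) Ga ->
  as_unique_infinite_cluster E (p_u E H : R) H.
Proof.
set q : R := p_u E Ga => hq.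
have q01 : 0 <= q <= 1 := p_u_ge0_le1 Ga.
have hqH : as_unique_infinite_cluster E q H.
  move=> mu hmu.
  exact: (unique_infinite_cluster_subgroup cG hmu sgGa sgH HGa iH (hq mu hmu)).
suff -> : p_u E H = q by [].
apply/eqP; rewrite eq_le p_u_le//=; apply: lb_le_inf; first by exists q.
move=> p [p01 hp]; rewrite leNgt; apply/negP => pq.
have /andP[p0 p1] := p01; have /andP[q0 q1] := q01.
pose s := (q - p) / (2 * (1 - p)).
have p10 : 0 < 2 * (1 - p) by lra.
have s0 : 0 < s by apply: divr_gt0; lra.
have s1 : s <= 1 by rewrite ler_pdivrMr//; lra.
have sE : (1 - p) * s = (q - p) / 2.
  by rewrite /s; field; apply/eqP; lra.
have := as_unique_infinite_cluster_sprinkle p01 _ hp (s := s).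
rewrite s0 s1 sE => /(_ isT) /(p_u_le _); rewrite -/q => h.
have : q <= p + (q - p) / 2 by apply: h; lra.
lra.
Qed.

End CriticalValues.

(** * Obstacles to uniqueness *)

Theorem corollary1p12 (R : realType) (Gamma : groupType) (H : set Gamma)
    (sgH : is_subgroup H) :
  countable [set: Gamma] ->
  wq_normal H ->
  obstacle_to_uniqueness R (subgroup_type sgH) ->
  obstacle_to_uniqueness R Gamma.
Proof.
move=> _ [iH wq] obsH G S finS genS f finj A uA.
have fM x y : f (x * y)%g = (f x * f y)%g by exact: gmulfM.
have f1 : f 1%g = 1%g.
  by apply: (mulgI (f 1%g)); rewrite -fM !mulg1.
have fV x : f x^-1%g = (f x)^-1%g.
  by apply: (mulgI (f x)); rewrite -fM !mulgV.
have sgi (B : set Gamma) : is_subgroup B -> is_subgroup (f @` B).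
  move=> sgB; split=> [|u v /set_mem[x Bx <-] /set_mem[y By <-]]; apply/mem_set.
    by exists 1%g => //; exact: subgroup1.
  by exists (x * y^-1)%g; [exact: subgroup_div|rewrite fM fV].
pose h (x : subgroup_type sgH) : G := f (val x).
have hM : {morph h : x y / (x * y)%g} by move=> x y; exact: fM (val x) (val y).
pose h' : {multiplicative subgroup_type sgH -> G} :=
  HB.pack h (isMultiplicative.Build _ _ h hM).
have hinj : injective h' by move=> x y /finj /val_inj.
apply: (obsH G S finS genS h' hinj) => /=.
have -> : range h' = f @` H.
  apply/seteqP; split=> x.
    by move=> [y _ <-]; exists (val y) => //; apply/set_mem; exact: (valP y).
  by move=> [y Hy <-]; exists (exist _ y (mem_set Hy)).
apply: (as_unique_at_p_u_subgroup finS genS _ (sgi H sgH) _ _ _ uA).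
- have sgT : is_subgroup [set: Gamma] by split=> [|u v _ _]; exact: in_setT.
  exact: sgi sgT.
- by move=> _ [x _ <-]; exists x.
- apply: contra_not iH => /(finite_preimage (f := f)) fH.
  by apply: sub_finite_set (fH _) => [x Hx|x y _ _ /finj//]; exists x.
- move=> I sgI HI IA neI.
  have sgI' : is_subgroup (f @^-1` I).
    split=> [|u v /set_mem Iu /set_mem Iv]; apply/mem_set; rewrite /preimage /=.
      by rewrite f1; exact: subgroup1.
    by rewrite fM fV; exact: subgroup_div.
  have [|neI'|g nIg iC] := wq _ sgI'.
  + by move=> x Hx; apply: HI; exists x.
  + apply: neI; apply/seteqP; split=> // _ [x _ <-].
    by have : (f @^-1` I) x by rewrite neI'.
  exists (f g); split=> //; first by exists g.
  apply: contra_not iC => /(finite_preimage (f := f)) fC.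
  apply: sub_finite_set (fC _) => [_ [[x Ix <-] Igx]|x y _ _ /finj//].
  by split=> //; exists (f x); rewrite // -fV -!fM.
Qed.
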